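(* Let $n\ge 3$ and let $T$ be a star-like tree: a tree with a central vertex $c$ of degree $n$ such that $T$ is the union of $n$ paths (branches) meeting only at $c$, each branch starting at $c$ and having length at least $2$. Let $V$ be the vertex set of $T$, let $P=\{(0,\infty),(1,4)\}$, and let $$\mathbf{data}_P=\{z\in\mathbb{R}^V:\mathrm{PH}_0(z)=P\}.$$ Then $\mathbf{data}_P$ is homotopy equivalent to a bouquet (wedge) of $n^2-3n+1$ circles.
   Context: A vector $z\in\mathbb{R}^V$ is viewed as a function on vertices, extended to edges by taking the maximum over the two endpoints. For $r\in\mathbb{R}$, $T_r(z)$ is the subcomplex consisting of vertices $v$ with $z_v\le r$ and edges $[v,w]$ with $\max\{z_v,z_w\}\le r$. $\mathrm{PH}_0(z)$ is the degree-$0$ persistence diagram (multiset of (birth, death) pairs, death possibly $\infty$) of the sublevel-set filtration $r\mapsto T_r(z)$. $\mathbf{data}_P$ has the subspace topology of $\mathbb{R}^V$. *)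

(* Defs.v *)
From HB Require Import structures.
From mathcomp Require Import all_boot all_order all_algebra.
From mathcomp Require Import all_classical all_reals all_analysis.
From mathcomp Require Import wedge_sigT.
Set Implicit Arguments.
Unset Strict Implicit.
Unset Printing Implicit Defensive.
Import Order.TTheory GRing.Theory Num.Theory.
Import numFieldNormedType.Exports.
Local Open Scope ring_scope.


(* Star-like tree with n branches, branch i having length l i (edges).
   Vertices: the centre [None] and [Some (Tagged i k)] = the vertex of branch i
   at distance k+1 from the centre (k < l i). *)
Notation starV n l := (option {i : 'I_n & 'I_(l i)}).

Definition star_adj (n : nat) (l : 'I_n -> nat) : rel (starV n l) :=
  fun u w =>
    match u, w with
    | None, None => false
    | None, Some x => nat_of_ord (tagged x) == 0%N
    | Some x, None => nat_of_ord (tagged x) == 0%N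
    | Some x, Some y =>
        (tag x == tag y) &&
        (((tagged x).+1 == tagged y :> nat) || ((tagged y).+1 == tagged x :> nat))
    end.

(* Edges of T_s : edges [u,w] with max(z_u, z_w) <= s (their endpoints are then
   automatically vertices of T_s). *)
Definition sub_edge (R : realType) (V : finType) (adj : rel V) (z : V -> R)
  (s : R) : rel V :=
  fun u w => adj u w && (Num.max (z u) (z w) <= s).

(* rank of H_0(T_r) -> H_0(T_s) (r <= s): the number of connected components
   of T_s that contain a vertex of T_r. *)
Definition ph0_rank (R : realType) (V : finType) (adj : rel V) (z : V -> R)
  (r s : R) : nat :=
  #|[set [set w | connect (sub_edge adj z s) v w] | v in [set v | z v <= r]]|.

(* PH_0(z) = D : D is the (finite) multiset of bars [b, d) (d possibly +oo,
   b < d) of the degree-0 persistence module r |-> H_0(T_r(z)); equivalently,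
   by the structure theorem, the multiset whose bars reproduce all ranks. *)
Definition PH0_is (R : realType) (V : finType) (adj : rel V) (z : V -> R)
  (D : seq (R * \bar R)) : Prop :=
  all (fun p => (p.1%:E < p.2)%E) D /\
  forall r s : R, r <= s ->
    ph0_rank adj z r s = count (fun p => (p.1 <= r) && (s%:E < p.2)%E) D.

Definition diagP (R : realType) : seq (R * \bar R) :=
  [:: (0, +oo%E); (1, 4%:E)].

(* R^V with the product (= Euclidean) topology *)
Definition dataP (R : realType) (V : finType) (adj : rel V) :
  set (prod_topology (fun _ : V => (R : Type))) :=
  [set z | PH0_is adj z (diagP R)]%classic.

Definition I01 (R : realType) : set R := `[0, 1]%classic.
Notation unit_interval R := (set_type (@I01 R)).

Definition homotopic (R : realType) (X Y : topologicalType) (f g : X -> Y) :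
  Prop :=
  exists H : (X * unit_interval R)%type -> Y,
    continuous H /\
    (forall x t, set_val t = 0 -> H (x, t) = f x) /\
    (forall x t, set_val t = 1 -> H (x, t) = g x).

Definition homotopy_equivalent (R : realType) (X Y : topologicalType) : Prop :=
  exists (f : X -> Y) (g : Y -> X),
    [/\ continuous f, continuous g,
        homotopic R (g \o f) idfun & homotopic R (f \o g) idfun].

Definition circle_set (R : realType) : set (R * R) :=
  [set p | p.1 ^+ 2 + p.2 ^+ 2 = 1]%classic.

Notation circle R := (set_type (@circle_set R)).

Lemma circle_base_mem (R : realType) : ((1 : R), (0 : R)) \in @circle_set R.
Proof. by rewrite inE /circle_set /= expr1n expr0n /= addr0. Qed.

Definition circle_base (R : realType) : circle R :=
  exist _ (1, 0) (circle_base_mem R).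

Notation bouquet R k := (wedge (fun _ : 'I_k => circle_base R)).

(* Main.v *)
(* Cutting [z] off at height 4 and writing it as [4 - 4 x - 3 y], where [x] lives
   on the basin of the minimum 0 and [y] on the basin of the minimum 1, turns a
   function with persistence diagram {(0, oo), (1, 4)} into a pair of unimodal
   bumps of height one whose supports are separated by at least one vertex. Such
   a pair behaves like a configuration of two distinct points on the star. For
   every pair, one of the bumps is confined to a branch, outside of the other
   one; these 2n closed conditions overlap only where both bumps are confined to
   different branches. On each of them three successive straight-line homotopies
   (let the inner bump spread up to the centre, push both bumps outwards, sharpen
   them) retract the pairs onto the crown graph K_{n,n} minus a perfect matching:
   a vertex says which bump is confined to which branch while the other one sits
   at the centre, an edge that the two are confined to different branches. This
   graph has 2n vertices and n(n-1) edges, so contracting a spanning tree leaves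
   n(n-1) - (2n-1) = n^2 - 3n + 1 loops. *)
Require Import Defs.
From HB Require Import structures.
From mathcomp Require Import all_boot all_order all_algebra.
From mathcomp Require Import all_classical all_reals all_analysis.
From mathcomp Require Import wedge_sigT.
From mathcomp Require Import ring lra zify.
Set Implicit Arguments.
Unset Strict Implicit.
Unset Printing Implicit Defensive.
Import Order.TTheory GRing.Theory Num.Theory.
Import numFieldNormedType.Exports.
Local Open Scope ring_scope.
Local Open Scope classical_set_scope.

(** The weights in [4 - 4 x - 3 y] are the depths of the two minima below level 4; dividing by them
    normalises both bumps to height one. The obstacle is continuity: neither the basin that contains
    a vertex nor the position of a peak depends continuously on the function. So no map may be
    defined by choosing a peak. All formulas are made of sums, products, maxima and minima, and a
    branch is chosen only on the members of a finite closed cover, which are glued afterwards. To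
    keep these members closed, separation of the bumps is expressed by vanishing products. Straight
    lines are admissible because bumps with a common peak form a convex set, so each stage of the
    retraction is arranged to share a peak with the next one. Branches of length at least two leave
    room for a bump that starts at distance two, the vertex at distance one being the gap to a bump
    at the centre. *)

Section Continuity.
Context {R : realType} {T : topologicalType}.
Implicit Types f g : T -> R.

Lemma cts_cst (a : R) : continuous (fun _ : T => a).
Proof. by move=> x; exact: cvg_cst. Qed.

Lemma ctsD f g : continuous f -> continuous g -> continuous (fun x => f x + g x).
Proof. by move=> cf cg x; apply: cvgD; [exact: cf|exact: cg]. Qed.

Lemma ctsN f : continuous f -> continuous (fun x => - f x).
Proof. by move=> cf x; apply: cvgN; exact: cf. Qed.

Lemma ctsM f g : continuous f -> continuous g -> continuous (fun x => f x * g x).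
Proof. by move=> cf cg x; apply: cvgM; [exact: cf|exact: cg]. Qed.

Lemma cts_max f g :
  continuous f -> continuous g -> continuous (fun x => Num.max (f x) (g x)).
Proof. by move=> cf cg x; apply: (@continuous_max R T f g x); [exact: cf|exact: cg]. Qed.

Lemma cts_min f g :
  continuous f -> continuous g -> continuous (fun x => Num.min (f x) (g x)).
Proof. by move=> cf cg x; apply: (@continuous_min R T f g x); [exact: cf|exact: cg]. Qed.

Lemma cts_sum (I : Type) (r : seq I) (P : pred I) (F : I -> T -> R) :
  (forall i, P i -> continuous (F i)) ->
  continuous (fun x => \sum_(i <- r | P i) F i x).
Proof.
move=> cF; apply: continuous_big => //.
by move=> x; apply: cvgD; [exact: cvg_fst|exact: cvg_snd].
Qed.

Lemma cts_bigmax (a : R) (I : Type) (r : seq I) (P : pred I) (F : I -> T -> R) :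
  (forall i, P i -> continuous (F i)) ->
  continuous (fun x => \big[Num.max/a]_(i <- r | P i) F i x).
Proof.
move=> cF; apply: continuous_big => //.
by move=> x; apply: (@continuous_max R _ fst snd x); [exact: cvg_fst|exact: cvg_snd].
Qed.

Lemma cts_if (b : bool) f g :
  continuous f -> continuous g -> continuous (fun x => if b then f x else g x).
Proof. by case: b. Qed.

Lemma cts_coord (I : eqType) (F : T -> prod_topology (fun _ : I => (R : Type))) i :
  continuous F -> continuous (fun t => F t i).
Proof.
move=> cF x; apply: (@continuous_comp T _ R F (proj i) x); first exact: cF.
exact: proj_continuous.
Qed.

Lemma cts_prod (I : eqType) (F : T -> prod_topology (fun _ : I => (R : Type))) :
  (forall i, continuous (fun t => F t i)) -> continuous F.
Proof.
move=> cF x; apply/cvg_sup => i.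
move: x; apply/(@continuousP _ (initial_topology (@^~ i))) => A [B oB <-].
have -> : F @^-1` (@^~ i @^-1` B) = (fun t => F t i) @^-1` B by [].
by apply: open_comp => // x _; exact: cF.
Qed.

End Continuity.

Lemma cts_comp (T U W : topologicalType) (g : U -> W) (f : T -> U) :
  continuous g -> continuous f -> continuous (fun x => g (f x)).
Proof. by move=> cg cf x; apply: (@continuous_comp _ _ _ f g); [exact: cf|exact: cg]. Qed.

Lemma cts_pair (T U W : topologicalType) (f : T -> U) (g : T -> W) :
  continuous f -> continuous g -> continuous (fun x => (f x, g x)).
Proof. by move=> cf cg x; apply: cvg_pair; [exact: cf|exact: cg]. Qed.

Lemma cts_fst (T U : topologicalType) : continuous (@fst T U).
Proof. by move=> x; exact: cvg_fst. Qed.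

Lemma cts_snd (T U : topologicalType) : continuous (@snd T U).
Proof. by move=> x; exact: cvg_snd. Qed.

Lemma cts_val (T : topologicalType) (A : set T) :
  continuous (set_val : set_type A -> T).
Proof. exact: initial_continuous. Qed.

Lemma cts_sub (T U : topologicalType) (A : set U) (f : T -> set_type A) :
  continuous (fun x => set_val (f x)) -> continuous f.
Proof. exact: continuous_comp_initial. Qed.


Lemma set_type_mem (T : Type) (A : set T) (x : set_type A) : A (set_val x).
Proof. exact: set_valP. Qed.

Definition to_sub (T U : Type) (A : set U) (f : T -> U) (fA : forall x, A (f x))
  (x : T) : set_type A := exist _ (f x) (mem_set (fA x)).

Lemma to_subE (T U : Type) (A : set U) (f : T -> U) (fA : forall x, A (f x)) x :
  set_val (to_sub fA x) = f x.
Proof. by []. Qed.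

Lemma set_val_inj (T : Type) (A : set T) (x y : set_type A) :
  set_val x = set_val y -> x = y.
Proof. exact: val_inj. Qed.

(** * Closed conditions and pasting on finite closed covers *)

Lemma closed_le0 (R : realType) (T : topologicalType) (f : T -> R) :
  continuous f -> closed [set x | f x <= 0].
Proof.
by move=> cf; apply: (@closed_comp T R f [set y : R| y <= 0]) => //; exact: closed_le.
Qed.

Lemma closed_ge0 (R : realType) (T : topologicalType) (f : T -> R) :
  continuous f -> closed [set x | 0 <= f x].
Proof.
by move=> cf; apply: (@closed_comp T R f [set y : R| 0 <= y]) => //; exact: closed_ge.
Qed.

Lemma closed_eq0 (R : realType) (T : topologicalType) (f : T -> R) :
  continuous f -> closed [set x | f x = 0].
Proof.
by move=> cf; apply: (@closed_comp T R f [set y : R| y = 0]) => //; exact: closed_eq.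
Qed.

Lemma closed_finU (T : topologicalType) (I : finType) (D : I -> set T) :
  (forall i, closed (D i)) -> closed [set x | exists i, D i x].
Proof.
move=> cD; rewrite (_ : [set x | _] = \big[setU/set0]_(i : I) D i).
  by apply: closed_bigsetU => i _; exact: cD.
apply/seteqP; split=> [x [i Di]|x].
  by rewrite -bigcup_seq; exists i => //=; rewrite mem_index_enum.
by rewrite -bigcup_seq => -[i _ Di]; exists i.
Qed.

Lemma closed_all (T : topologicalType) (I : Type) (D : I -> set T) :
  (forall i, closed (D i)) -> closed [set x | forall i, D i x].
Proof.
move=> cD; rewrite (_ : [set x | _] = \bigcap_i D i).
  by apply: closed_bigI => i _; exact: cD.
by apply/seteqP; split=> [x xD i _|x xD i]; exact: xD.
Qed.

(** Each of the finitely many pieces either contains the point, and then its map is continuous there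
    with the common value, or misses a neighbourhood of it. Intersecting these neighbourhoods makes
    any pointwise choice of a piece continuous. *)
Lemma glue_closed (T U : topologicalType) (I : finType) (D : I -> set T)
    (F : I -> T -> U) :
  (forall i, closed (D i)) -> (forall i, continuous (F i)) ->
  (forall t, exists i, D i t) ->
  (forall i j t, D i t -> D j t -> F i t = F j t) ->
  exists f : T -> U, continuous f /\ forall i t, D i t -> f t = F i t.
Proof.
move=> cD cF cov agree.
have [k Dk] := choice cov.
exists (fun t => F (k t) t); split; last by move=> i t Dt; exact: agree.
move=> t A At.
have h0 : nbhs t [set s | forall i, D i s -> A (F i s)].
  apply: filter_forall => i; have [Dit|nDit] := pselect (D i t).
    have h : nbhs t (F i @^-1` A) by apply: (cF i t); rewrite (agree i (k t)).
    by apply: filterS h => s As _.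
  have : nbhs t (~` D i) by apply: open_nbhs_nbhs; split => //; exact: closed_openC.
  by apply: filterS => s nD /nD.
by apply: filterS h0 => s /(_ (k s)) /(_ (Dk s)).
Qed.

(** * Homotopy as an equivalence relation, and composition of equivalences *)

Section Homotopy.
Context {R : realType}.

Lemma clamp01_subproof (t : R) : I01 (Num.max 0 (Num.min 1 t)).
Proof. by rewrite /I01/= in_itv/= le_max lexx/= ge_max ler01 ge_min lexx. Qed.

(** A retraction of the line onto the interval, so that reversal and concatenation of homotopies can
    be written with plain arithmetic in [R]. *)
Definition clampI (t : R) : unit_interval R :=
  to_sub (clamp01_subproof) t.

Lemma clampIE t : set_val (clampI t) = Num.max 0 (Num.min 1 t).
Proof. by []. Qed.

Lemma cts_clampI : continuous clampI.
Proof.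
apply: cts_sub => /=; apply: cts_max; first exact: cts_cst.
by apply: cts_min; [exact: cts_cst|move=> x].
Qed.

Lemma clampI0 (t : R) : t <= 0 -> set_val (clampI t) = 0.
Proof. by move=> t0; rewrite clampIE min_r ?max_l//; lra. Qed.

Lemma clampI1 (t : R) : 1 <= t -> set_val (clampI t) = 1.
Proof. by move=> t1; rewrite clampIE min_l ?max_r//; lra. Qed.


Lemma unit_intervalP (t : unit_interval R) : 0 <= set_val t <= 1.
Proof. by have := set_type_mem t; rewrite /I01/= in_itv. Qed.

Lemma homotopic_refl (X Y : topologicalType) (f : X -> Y) :
  continuous f -> homotopic R f f.
Proof.
move=> cf; exists (fun p => f p.1); split=> //.
exact: cts_comp cf (@cts_fst _ _).
Qed.

Lemma homotopic_sym (X Y : topologicalType) (f g : X -> Y) :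
  homotopic R f g -> homotopic R g f.
Proof.
move=> [H [cH [H0 H1]]]; exists (fun p => H (p.1, clampI (1 - set_val p.2))).
split; last split.
- apply: cts_comp cH _; apply: cts_pair; first exact: cts_fst.
  apply: cts_comp cts_clampI _; apply: ctsD; first exact: cts_cst.
  by apply: ctsN; apply: cts_comp (@cts_snd _ _); exact: cts_val.
- by move=> x t t0; apply: H1; rewrite /= t0 subr0 clampI1.
- by move=> x t t1; apply: H0; rewrite /= t1 subrr clampI0.
Qed.

Lemma homotopic_trans (X Y : topologicalType) (f g h : X -> Y) :
  homotopic R f g -> homotopic R g h -> homotopic R f h.
Proof.
move=> [H [cH [H0 H1]]] [K [cK [K0 K1]]].
have ct : continuous (fun p : X * unit_interval R => set_val p.2 : R).
  by apply: cts_comp (@cts_snd _ _); exact: cts_val.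
pose D (b : bool) := [set p : X * unit_interval R |
  if b then 2 * set_val p.2 - 1 <= 0 else 0 <= 2 * set_val p.2 - 1].
pose F (b : bool) (p : X * unit_interval R) := if b
  then H (p.1, clampI (2 * set_val p.2)) else K (p.1, clampI (2 * set_val p.2 - 1)).
have c2 : continuous (fun p : X * unit_interval R => 2 * set_val p.2 : R).
  by apply: ctsM => //; exact: cts_cst.
have c21 : continuous (fun p : X * unit_interval R => 2 * set_val p.2 - 1 : R).
  by apply: ctsD => //; exact: cts_cst.
have [||||J [cJ JE]] := @glue_closed _ Y bool D F.
- by case; [exact: closed_le0|exact: closed_ge0].
- case; rewrite /F; [apply: cts_comp cH _|apply: cts_comp cK _];
    by (apply: cts_pair; [exact: cts_fst|apply: cts_comp cts_clampI _]).
- move=> p; have [h1|h1] := leP (2 * set_val p.2 - 1) 0; first by exists true.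
  by exists false; exact: ltW.
- have E (p : X * unit_interval R) : D true p -> D false p -> F true p = F false p.
    rewrite /D /= => h1 h2; rewrite H1 ?K0 //; first by rewrite clampI0.
    by rewrite clampI1//; lra.
  by move=> [] [] p // h1 h2; [exact: E|exact/esym/E].
exists J; split=> //; split=> x t tE.
- rewrite (JE true); first by rewrite /F H0//= clampI0 ?tE ?mulr0.
  by rewrite /D/= tE; lra.
- rewrite (JE false); first by rewrite /F K1//= clampI1 ?tE //; lra.
  by rewrite /D/= tE; lra.
Qed.

Lemma homotopic_comp (X Y Z W : topologicalType) (k : Z -> X) (f g : X -> Y)
    (h : Y -> W) : continuous k -> continuous h ->
  homotopic R f g -> homotopic R (h \o f \o k) (h \o g \o k).
Proof.
move=> ck ch [H [cH [H0 H1]]]; exists (fun p => h (H (k p.1, p.2))).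
split; last by split=> x t t0; rewrite /= ?(H0 _ _ t0) ?(H1 _ _ t0).
apply: cts_comp ch _; apply: cts_comp cH _; apply: cts_pair; last exact: cts_snd.
exact: cts_comp ck (@cts_fst _ _).
Qed.

Lemma homotopy_equivalent_trans (X Y Z : topologicalType) :
  homotopy_equivalent R X Y -> homotopy_equivalent R Y Z ->
  homotopy_equivalent R X Z.
Proof.
move=> [f [g [cf cg gf fg]]] [f' [g' [cf' cg' gf' fg']]].
exists (f' \o f), (g \o g'); split.
- exact: cts_comp cf' cf.
- exact: cts_comp cg cg'.
- exact: homotopic_trans (homotopic_comp cf cg gf') gf.
- exact: homotopic_trans (homotopic_comp cg' cf' fg) fg'.
Qed.

End Homotopy.

(** * Three-stage straight-line homotopies *)

Section Clamp.
Context {R : realType}.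

Definition cl01 (t : R) : R := Num.max 0 (Num.min 1 t).

Lemma cl01P (t : R) : 0 <= cl01 t <= 1.
Proof. by rewrite /cl01 le_max lexx/= ge_max ler01 ge_min lexx. Qed.

Lemma cl01_0 (t : R) : t <= 0 -> cl01 t = 0.
Proof. by move=> t0; rewrite /cl01 min_r ?max_l//; lra. Qed.

Lemma cl01_1 (t : R) : 1 <= t -> cl01 t = 1.
Proof. by move=> t1; rewrite /cl01 min_l ?max_r//; lra. Qed.

Lemma cts_cl01 (T : topologicalType) (f : T -> R) :
  continuous f -> continuous (fun x => cl01 (f x)).
Proof.
move=> cf; apply: cts_max; first exact: cts_cst.
by apply: cts_min => //; exact: cts_cst.
Qed.

(* A polygonal path through four points: the terms switch on one after another,
   so every value lies on one of the three segments. *)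
Definition chain3 (a0 a1 a2 a3 t : R) : R :=
  a0 + cl01 (3 * t) * (a1 - a0) + cl01 (3 * t - 1) * (a2 - a1)
     + cl01 (3 * t - 2) * (a3 - a2).

(** The segment and the parameter [s] depend on [t] alone, not on the four points. The same convex
    combination is therefore valid in all coordinates at once, and convexity arguments apply to
    whole functions. *)
Lemma chain3P (t : R) : exists s : R, 0 <= s <= 1 /\
  [\/ forall a0 a1 a2 a3, chain3 a0 a1 a2 a3 t = (1 - s) * a0 + s * a1,
      forall a0 a1 a2 a3, chain3 a0 a1 a2 a3 t = (1 - s) * a1 + s * a2 |
      forall a0 a1 a2 a3, chain3 a0 a1 a2 a3 t = (1 - s) * a2 + s * a3].
Proof.
rewrite /chain3.
have [t1|t1] := leP (3 * t) 1.
  exists (cl01 (3 * t)); split; first exact: cl01P.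
  constructor 1 => a0 a1 a2 a3.
  by rewrite (@cl01_0 (3 * t - 1)) ?(@cl01_0 (3 * t - 2)); lra.
have [t2|t2] := leP (3 * t) 2.
  exists (cl01 (3 * t - 1)); split; first exact: cl01P.
  constructor 2 => a0 a1 a2 a3.
  by rewrite (@cl01_1 (3 * t)) ?(@cl01_0 (3 * t - 2)); lra.
exists (cl01 (3 * t - 2)); split; first exact: cl01P.
constructor 3 => a0 a1 a2 a3.
by rewrite (@cl01_1 (3 * t)) ?(@cl01_1 (3 * t - 1)); lra.
Qed.

Lemma chain3_0 (a0 a1 a2 a3 t : R) : t <= 0 -> chain3 a0 a1 a2 a3 t = a0.
Proof. by move=> t0; rewrite /chain3 !cl01_0 ?mul0r ?addr0; lra. Qed.

Lemma chain3_1 (a0 a1 a2 a3 t : R) : 1 <= t -> chain3 a0 a1 a2 a3 t = a3.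
Proof. by move=> t0; rewrite /chain3 !cl01_1; lra. Qed.

Lemma cts_chain3 (T : topologicalType) (f0 f1 f2 f3 g : T -> R) :
  continuous f0 -> continuous f1 -> continuous f2 -> continuous f3 ->
  continuous g -> continuous (fun x => chain3 (f0 x) (f1 x) (f2 x) (f3 x) (g x)).
Proof.
move=> c0 c1 c2 c3 cg.
have c3g (a : R) : continuous (fun x => 3 * g x - a).
  by apply: ctsD; [apply: ctsM => //|]; exact: cts_cst.
have cB (f h : T -> R) : continuous f -> continuous h -> continuous (fun x => f x - h x).
  by move=> cf ch; apply: ctsD => //; exact: ctsN.
apply: ctsD; [apply: ctsD; [apply: ctsD => //|]|]; apply: ctsM => //; try exact: cB;
  apply: cts_cl01 => //.
by apply: ctsM => //; exact: cts_cst.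
Qed.

End Clamp.

(** * The circle as an interval with its endpoints identified *)

Section Circle.
Context {R : realType}.

Definition cneg (r : R) : R := cl01 (- r).
Definition cpos (r : R) : R := cl01 r.

Lemma cneg_cpos (r : R) : cneg r = 0 \/ cpos r = 0.
Proof.
have [r0|r0] := leP r 0; [right|left]; rewrite ?/cneg ?/cpos cl01_0//; lra.
Qed.

(** At most one of [cneg r] and [cpos r] is nonzero. With q for that one, the identity (2q - 1)^2 +
    4q(1 - q) = 1 puts the point on the circle, without trigonometric functions. Negative [r] runs
    through the upper half; [r = 0] is opposite to the base point. *)
Lemma loop_subproof (r : R) : circle_set
  (2 * (cneg r + cpos r) - 1,
   2 * Num.sqrt (cneg r * (1 - cneg r)) - 2 * Num.sqrt (cpos r * (1 - cpos r))).
Proof.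
rewrite /circle_set/=.
have S (q : R) : 0 <= q <= 1 -> Num.sqrt (q * (1 - q)) ^+ 2 = q * (1 - q).
  by move=> /andP[q0 q1]; rewrite sqr_sqrtr// mulr_ge0// subr_ge0.
have /S Sn := cl01P (- r); have /S Sp := cl01P r.
have [n0|p0] := cneg_cpos r.
- rewrite n0 !(mul0r, sqrtr0, mulr0, add0r) sqrrN exprMn Sp.
  by rewrite -/(cpos r); ring.
- by rewrite p0 !(mul0r, sqrtr0, mulr0, addr0, subr0) exprMn Sn -/(cneg r); ring.
Qed.

(* [-1, 1] wraps once around the circle; outside of it the loop is constant. *)
Definition loop : R -> circle R := to_sub loop_subproof.

Lemma cts_loop : continuous loop.
Proof.
apply: cts_sub; rewrite /loop.
have cid : continuous (fun r : R => r) by move=> x.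
have cn : continuous cneg by apply: cts_cl01; exact: ctsN.
have cp : continuous cpos by apply: cts_cl01.
have sq (f : R -> R) : continuous f ->
    continuous (fun r => 2 * Num.sqrt (f r * (1 - f r))).
  move=> cf; apply: ctsM; first exact: cts_cst.
  apply: (cts_comp (@sqrt_continuous R)); apply: ctsM => //.
  by apply: ctsD; [exact: cts_cst|exact: ctsN].
apply: cts_pair.
  apply: ctsD; last exact: cts_cst.
  by apply: ctsM; [exact: cts_cst|exact: ctsD].
by apply: ctsD; [exact: sq|apply: ctsN; exact: sq].
Qed.

Lemma loop_base (r : R) : (r <= -1) || (1 <= r) -> loop r = circle_base R.
Proof.
move=> /orP[] h; apply: set_val_inj; rewrite /loop to_subE /cneg /cpos;
  change (set_val (circle_base R)) with ((1 : R), (0 : R)).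
- have -> : cl01 (- r) = 1 by apply: cl01_1; lra.
  have -> : cl01 r = 0 by apply: cl01_0; lra.
  by rewrite subrr !(mulr0, mul0r, sqrtr0, addr0, subr0, mulr1); congr pair; lra.
- have -> : cl01 r = 1 by apply: cl01_1; lra.
  have -> : cl01 (- r) = 0 by apply: cl01_0; lra.
  by rewrite subrr !(mulr0, mul0r, sqrtr0, add0r, subr0, mulr1); congr pair; lra.
Qed.

(** Continuous sections of [loop] over the closed upper and lower half circles. At the base point
    they take the values -1 and 1. *)
Definition arg_up (c : circle R) : R := - ((1 + (set_val c).1) / 2).
Definition arg_dn (c : circle R) : R := (1 + (set_val c).1) / 2.

Lemma circleP (c : circle R) :
  [/\ (set_val c).1 ^+ 2 + (set_val c).2 ^+ 2 = 1, -1 <= (set_val c).1 &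
      (set_val c).1 <= 1].
Proof.
have /= e := set_type_mem c; rewrite /circle_set/= in e; split=> //; nra.
Qed.

Lemma arg_range (c : circle R) : 0 <= arg_dn c <= 1.
Proof. by have [_ ? ?] := circleP c; rewrite /arg_dn; lra. Qed.

Lemma arg_sqrt (c : circle R) :
  2 * Num.sqrt (arg_dn c * (1 - arg_dn c)) = `|(set_val c).2|.
Proof.
have [e h1 h2] := circleP c; have /andP[q0 q1] := arg_range c.
have -> : arg_dn c * (1 - arg_dn c) = ((set_val c).2 / 2) ^+ 2.
  by rewrite /arg_dn; lra.
by rewrite sqrtr_sqr normrM (@ger0_norm _ 2^-1) ?invr_ge0//; lra.
Qed.

Lemma loop_up (c : circle R) : 0 <= (set_val c).2 -> loop (arg_up c) = c.
Proof.
move=> c2; apply: set_val_inj; rewrite /loop to_subE.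
have /andP[q0 q1] := arg_range c.
have -> : cneg (arg_up c) = arg_dn c.
  by rewrite /cneg /arg_up opprK /cl01 min_r ?max_r.
have -> : cpos (arg_up c) = 0 by rewrite /cpos cl01_0 // /arg_up -/(arg_dn c); lra.
rewrite mul0r sqrtr0 arg_sqrt ger0_norm// addr0 mulr0 subr0 /arg_dn.
by case: (set_val c) => a b /=; congr pair; lra.
Qed.

Lemma loop_dn (c : circle R) : (set_val c).2 <= 0 -> loop (arg_dn c) = c.
Proof.
move=> c2; apply: set_val_inj; rewrite /loop to_subE.
have /andP[q0 q1] := arg_range c.
have -> : cpos (arg_dn c) = arg_dn c by rewrite /cpos /cl01 min_r ?max_r.
have -> : cneg (arg_dn c) = 0 by rewrite /cneg cl01_0 //; lra.
rewrite mul0r sqrtr0 arg_sqrt ler0_norm// add0r mulr0 sub0r opprK /arg_dn.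
by case: (set_val c) => a b /=; congr pair; lra.
Qed.

Lemma loop_surj (c : circle R) : exists2 r, -1 <= r <= 1 & loop r = c.
Proof.
have := arg_range c; have [c2|c2] := leP 0 (set_val c).2 => h.
- by exists (arg_up c); [rewrite /arg_up -/(arg_dn c); lra|exact: loop_up].
- by exists (arg_dn c); [lra|apply: loop_dn; exact: ltW].
Qed.

Lemma loop_inj (r r' : R) : -1 <= r <= 1 -> -1 <= r' <= 1 -> loop r = loop r' ->
  [\/ r = r', r = 1 /\ r' = -1 | r = -1 /\ r' = 1].
Proof.
move=> h h'.
have nE (x : R) : -1 <= x <= 1 -> (x <= 0 /\ cneg x = - x /\ cpos x = 0) \/
    (0 <= x /\ cneg x = 0 /\ cpos x = x).
  move=> hx; rewrite /cneg /cpos; have [x0|/ltW x0] := leP x 0; [left|right].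
  - by rewrite (@cl01_0 R x)// /cl01 min_r ?max_r//; lra.
  - by rewrite (@cl01_0 R (- x)) ?/cl01 ?min_r ?max_r//; lra.
move=> /(congr1 set_val); rewrite /loop !to_subE => -[].
have S (q : R) : 0 <= q <= 1 -> Num.sqrt (q * (1 - q)) = 0 -> q = 0 \/ q = 1.
  move=> /andP[q0 q1] /eqP; rewrite sqrtr_eq0 => h0; nra.
have [[r0 [-> ->]]|[r0 [-> ->]]] := nE r h;
have [[s0 [-> ->]]|[s0 [-> ->]]] := nE r' h'; rewrite ?(mul0r, sqrtr0) => e1 e2.
- by constructor 1; lra.
- have e : r' = - r by lra.
  subst r'; have := sqrtr_ge0 (- r * (1 - - r)) => hs.
  case: (S (- r)) => [||?|?]; [by lra|by lra| |].
  + by constructor 1; lra.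
  + by constructor 3; lra.
- have e : r = - r' by lra.
  subst r; have := sqrtr_ge0 (- r' * (1 - - r')) => hs.
  case: (S (- r')) => [||?|?]; [by lra|by lra| |].
  + by constructor 1; lra.
  + by constructor 2; lra.
- by constructor 1; lra.
Qed.

(** The quotient property of [loop], with a parameter space [W] that later carries the time of a
    homotopy. Continuity comes from pasting the two closed half circles, over which [loop] has
    continuous sections. *)
Lemma circle_factor (W Y : topologicalType) (F : R * W -> Y) :
  continuous F -> (forall w, F (1, w) = F (-1, w)) ->
  exists Th : W * circle R -> Y, continuous Th /\
    forall w r, -1 <= r <= 1 -> Th (w, loop r) = F (r, w).
Proof.
move=> cF FE.
have c1 : continuous (fun p : W * circle R => (set_val p.2).1 : R).
  apply: (cts_comp (@cts_fst R R)); apply: (cts_comp (@cts_val _ _)); exact: cts_snd.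
have c2 : continuous (fun p : W * circle R => (set_val p.2).2 : R).
  apply: (cts_comp (@cts_snd R R)); apply: (cts_comp (@cts_val _ _)); exact: cts_snd.
pose D (b : bool) := [set p : W * circle R |
  if b then 0 <= (set_val p.2).2 else (set_val p.2).2 <= 0].
pose G (b : bool) (p : W * circle R) :=
  F (if b then arg_up p.2 else arg_dn p.2, p.1).
have key w r r' : -1 <= r <= 1 -> -1 <= r' <= 1 -> loop r = loop r' ->
    F (r, w) = F (r', w).
  by move=> h h' /(loop_inj h h')[->|[-> ->]|[-> ->]].
have rup c : -1 <= arg_up c <= 1.
  by have := arg_range c; rewrite /arg_up -/(arg_dn c); lra.
have rdn c : -1 <= arg_dn c <= 1 by have := arg_range c; lra.
have [||||Th [cTh ThE]] := @glue_closed _ Y bool D G.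
- by case; [exact: closed_ge0|exact: closed_le0].
- have cdn : continuous (fun p : W * circle R => arg_dn p.2).
    apply: ctsM; last exact: cts_cst.
    by apply: ctsD => //; exact: cts_cst.
  by case; rewrite /G; apply: (cts_comp cF); apply: cts_pair;
    [exact: ctsN|exact: cts_fst|exact: cdn|exact: cts_fst].
- move=> p; have [h|/ltW h] := leP 0 (set_val p.2).2; first by exists true.
  by exists false.
- have E p : D true p -> D false p -> G true p = G false p.
    by rewrite /D/= => h1 h2; apply: key => //; rewrite loop_up ?loop_dn.
  by move=> [] [] p // h1 h2; [exact: E|exact/esym/E].
exists Th; split=> // w r rr.
have [h|/ltW h] := leP 0 (set_val (loop r)).2.
- by rewrite (ThE true)// /G/=; apply: key => //; rewrite loop_up.
- by rewrite (ThE false)// /G/=; apply: key => //; rewrite loop_dn.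
Qed.

Lemma closed_circle_base : closed [set circle_base R].
Proof.
rewrite (_ : [set _] = [set c : circle R | (set_val c).1 - 1 = 0]).
  apply: closed_eq0; apply: ctsD; last exact: cts_cst.
  by apply: (cts_comp (@cts_fst R R)); exact: cts_val.
apply/seteqP; split=> [c ->|c /= c1]; first by rewrite /= subrr.
have [e _ _] := circleP c; apply: set_val_inj.
have c2 : (set_val c).2 = 0 by nra.
by move: c1 c2; case: (set_val c) => a b /= ? ->; congr pair; lra.
Qed.

End Circle.

(** * Metric graphs and bouquets *)

Section Segments.
Context {R : realType} {V : finType}.
Local Notation E := (prod_topology (fun _ : V => (R : Type))).
Implicit Types (g : E) (v w : V).

(** An edge of the geometric realisation, in barycentric coordinates indexed by [V]. *)
Definition seg v w : set E := [set g | [/\ forall x, 0 <= g x,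
  forall x, x != v -> x != w -> g x = 0 & \sum_x g x = 1]].

Definition pt v : E := fun x => (x == v)%:R.

(** The affine extension of a vertex map: the mass at [x] moves to [phi x]. *)
Definition push (phi : V -> V) g : E := fun y => \sum_(x | phi x == y) g x.

Lemma cts_coordE (x : V) : continuous (fun g : E => g x).
Proof. by apply: (@cts_coord R E V (fun g => g) x) => g. Qed.

Lemma closed_seg v w : closed (seg v w).
Proof.
rewrite (_ : seg v w = [set g | forall x : V, 0 <= g x] `&`
    [set g | forall x : V, (if (x != v) && (x != w) then g x else 0) = 0] `&`
    [set g : E | \sum_x g x - 1 = 0]).
  apply: closedI; [apply: closedI|].
  - by apply: closed_all => x; apply: closed_ge0; exact: cts_coordE.
  - apply: closed_all => x; apply: closed_eq0; apply: cts_if; last exact: cts_cst.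
    exact: cts_coordE.
  - apply: closed_eq0; apply: ctsD; last exact: cts_cst.
    by apply: cts_sum => x _; exact: cts_coordE.
apply/seteqP; split=> g /=.
- move=> [g0 gvw g1]; split; last by rewrite g1 subrr.
  by split=> // x; case: ifP => // /andP[? ?]; exact: gvw.
- move=> [[g0 gvw] g1]; split=> //; last by apply/eqP; rewrite -subr_eq0; apply/eqP.
  by move=> x xv xw; have := gvw x; rewrite xv xw.
Qed.

Lemma segC v w : seg v w = seg w v.
Proof.
by apply/seteqP; split=> g [h1 h2 h3]; split=> // x xv xw; apply: h2.
Qed.

Lemma sum_pt v : \sum_x pt v x = 1.
Proof. by rewrite (bigD1 v)//= /pt eqxx big1 ?addr0// => x /negPf->. Qed.

Lemma pt_seg v w : seg v w (pt v).
Proof.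
split; last exact: sum_pt; first by move=> x; rewrite /pt ler0n.
by move=> x /negPf xv _; rewrite /pt xv.
Qed.

Lemma seg_convex v w g g' (s : R) : 0 <= s <= 1 -> seg v w g -> seg v w g' ->
  seg v w (fun x => (1 - s) * g x + s * g' x).
Proof.
move=> /andP[s0 s1] [h1 h2 h3] [k1 k2 k3]; split.
- by move=> x; rewrite addr_ge0// mulr_ge0// subr_ge0.
- by move=> x xv xw; rewrite h2// k2// !mulr0 addr0.
- by rewrite big_split/= -!mulr_sumr h3 k3; lra.
Qed.

Lemma push_seg phi v w a b g : seg v w g ->
  phi v \in [:: a; b] -> phi w \in [:: a; b] -> seg a b (push phi g).
Proof.
move=> [h1 h2 h3] va wa; split.
- by move=> y; apply: sumr_ge0.
- move=> y ya yb; rewrite /push big1// => x /eqP xy; apply: h2.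
  + by apply: contra_neq ya => xv; move: va yb; rewrite -xv xy !inE => /orP[]/eqP->//; rewrite eqxx.
  + by apply: contra_neq ya => xv; move: wa yb; rewrite -xv xy !inE => /orP[]/eqP->//; rewrite eqxx.
- by rewrite -h3 /push [RHS](partition_big phi xpredT).
Qed.

Lemma push_id g : push id g = g.
Proof. by apply/funext => y; rewrite /push big_pred1_eq. Qed.

Lemma push_cst a v w g : seg v w g -> push (fun=> a) g = pt a.
Proof.
move=> [_ _ h]; apply/funext => y; rewrite /push /pt.
rewrite (eq_bigl (fun=> y == a)) => [|x]; last by rewrite eq_sym.
by case: eqP => _ /=; rewrite ?h// big_pred0.
Qed.

Lemma cts_push phi y : continuous (fun g : E => push phi g y).
Proof. by apply: cts_sum => x _; exact: cts_coordE. Qed.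

Lemma seg_pair v w g : v != w -> seg v w g ->
  g = (fun x => g v * pt v x + g w * pt w x) /\ g v + g w = 1.
Proof.
move=> vw [h1 h2 h3]; split.
  apply/funext => x; rewrite /pt; have [->|xv] := eqVneq x v.
    by rewrite (negPf vw) mulr1 mulr0 addr0.
  have [->|xw] := eqVneq x w; first by rewrite mulr1 mulr0 add0r.
  by rewrite h2// !mulr0 addr0.
move: h3; rewrite (bigD1 v)//= (bigD1 w) 1?eq_sym//= big1 ?addr0//.
by move=> x /andP[? ?]; exact: h2.
Qed.

(** The coordinate of an endpoint that is missing from the second segment vanishes on it, so all the
    mass sits at the other endpoint. *)
Lemma seg_cross v w v' w' g : v != w -> ~~ ((v \in [:: v'; w']) && (w \in [:: v'; w'])) ->
  seg v w g -> seg v' w' g -> g = pt v \/ g = pt w.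
Proof.
move=> vw nin s /[dup] s' [_ h _]; have [gE g1] := seg_pair vw s.
move: nin; rewrite negb_and => /orP[]; rewrite !inE negb_or => /andP[a1 a2].
- right; rewrite gE; have g0 := h _ a1 a2; rewrite g0 add0r in g1.
  by apply/funext => x; rewrite g0 g1 mul0r mul1r add0r.
- left; rewrite gE; have g0 := h _ a1 a2; rewrite g0 addr0 in g1.
  by apply/funext => x; rewrite g0 g1 mul0r mul1r addr0.
Qed.

End Segments.

Arguments pt {R V} v.

(** * Collapsing a contractible spanning subgraph *)

Section GraphBouquet.
Context {R : realType} {V : finType} (N : nat) (e : 'I_N -> V * V) (tree : rel V)
  (phi1 phi2 : V -> V) (root : V).
Local Notation E := (prod_topology (fun _ : V => (R : Type))).
Hypothesis N0 : (0 < N)%N.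
Hypothesis e_loopless : forall i, (e i).1 != (e i).2.
Hypothesis tree_e : forall v w i, tree v w ->
  ~~ (((e i).1 \in [:: v; w]) && ((e i).2 \in [:: v; w])).
Hypothesis e_inj : forall i j, i != j ->
  ~~ (((e i).1 \in [:: (e j).1; (e j).2]) && ((e i).2 \in [:: (e j).1; (e j).2])).
Hypothesis tree_cover : forall v, exists w, tree v w.
(** Contiguity of simplicial maps: a straight line between the two images of a point of the tree
    stays inside one tree edge. The chain from [id] through [phi1] and [phi2] to a constant is the
    form in which contractibility of the tree is used. *)
Definition contiguous (f g : V -> V) := forall v w, tree v w ->
  exists a b, tree a b /\ all (mem [:: a; b]) [:: f v; f w; g v; g w].
Hypothesis tree01 : contiguous id phi1.
Hypothesis tree12 : contiguous phi1 phi2.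
Hypothesis tree23 : contiguous phi2 (fun=> root).

Definition tree_set : set E := [set g | exists p : V * V, tree p.1 p.2 /\ seg p.1 p.2 g].
Definition graph_set : set E :=
  [set g | exists o : option 'I_N,
     if o is Some i then seg (e i).1 (e i).2 g else tree_set g].

Lemma closed_tree_set : closed tree_set.
Proof.
pose D (p : V * V) : set E := if tree p.1 p.2 then seg p.1 p.2 else set0.
rewrite (_ : tree_set = [set g | exists p, D p g]).
  by apply: closed_finU => p; rewrite /D; case: ifP => _; [exact: closed_seg|exact: closed0].
apply/seteqP; split=> g /= [p]; rewrite /D.
- by move=> [tp gp]; exists p; rewrite tp.
- by case: ifP => // tp gp; exists p.
Qed.

Definition contract (g : E) (t : R) : E :=
  fun x => chain3 (g x) (push phi1 g x) (push phi2 g x) (push (fun=> root) g x) t.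

Lemma contract_cts (T : topologicalType) (f : T -> E) (h : T -> R) :
  continuous f -> continuous h -> continuous (fun x => contract (f x) (h x)).
Proof.
move=> cf ch; apply: cts_prod => x; apply: cts_chain3 => //.
- exact: (cts_comp (@cts_coordE R V x) cf).
- exact: (cts_comp (@cts_push R V _ x) cf).
- exact: (cts_comp (@cts_push R V _ x) cf).
- exact: (cts_comp (@cts_push R V _ x) cf).
Qed.

Lemma contract0 g (t : R) : t <= 0 -> contract g t = g.
Proof. by move=> t0; apply/funext => x; exact: chain3_0. Qed.

Lemma contract1 v w g (t : R) : seg v w g -> 1 <= t -> contract g t = pt root.
Proof.
move=> gs t1; rewrite -(push_cst root gs).
by apply/funext => x; exact: chain3_1.
Qed.

Lemma contract_tree g (t : R) : tree_set g -> tree_set (contract g t).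
Proof.
move=> [[v w] /= [vw gs]]; have [s [s01 sE]] := chain3P t.
have key f h : contiguous f h ->
    tree_set (fun x => (1 - s) * push f g x + s * push h g x).
  move=> /(_ _ _ vw)[a [b [ab /=]]]; rewrite andbT => /and4P[h1 h2 h3 h4].
  by exists (a, b); split=> //; apply: seg_convex => //; apply: push_seg gs _ _.
case: sE => sE.
- by move/key: tree01; rewrite push_id; congr tree_set; apply/funext => x; rewrite /contract sE.
- by move/key: tree12; congr tree_set; apply/funext => x; rewrite /contract sE.
- by move/key: tree23; congr tree_set; apply/funext => x; rewrite /contract sE.
Qed.

Lemma pt_tree v : tree_set (pt v).
Proof. by have [w vw] := tree_cover v; exists (v, w); split => //; exact: pt_seg. Qed.

Definition clpm (r : R) : R := Num.max (-1) (Num.min 1 r).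

(* The edge stretched by the factor r reaches past its endpoints and continues
   there along the contraction of the tree. *)
Definition stretch i (r : R) : E := fun x =>
  (1 - clpm r) / 2 * pt (e i).1 x + (1 + clpm r) / 2 * pt (e i).2 x
  + (contract (pt (e i).2) (r - 1) x - pt (e i).2 x)
  + (contract (pt (e i).1) (- r - 1) x - pt (e i).1 x).

Lemma stretch_cts (T : topologicalType) (f : T -> R) i :
  continuous f -> continuous (fun x => stretch i (f x)).
Proof.
move=> cf; apply: cts_prod => x; rewrite /stretch.
have cc : continuous (fun t => clpm (f t)).
  by apply: cts_max; [exact: cts_cst|apply: cts_min => //; exact: cts_cst].
have cN : continuous (fun t => - f t - 1).
  by apply: ctsD; [exact: ctsN|exact: cts_cst].
have cP : continuous (fun t => f t - 1) by apply: ctsD => //; exact: cts_cst.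
have cE (h : T -> E) : continuous h -> continuous (fun t => h t x).
  by move=> ch; exact: (cts_comp (@cts_coordE R V x) ch).
have cst (a : E) : continuous (fun _ : T => a) by move=> t; exact: cvg_cst.
have cC (a : V) (h : T -> R) : continuous h ->
    continuous (fun t => contract (pt a) (h t) x - pt a x).
  move=> ch; apply: ctsD; last exact: cts_cst.
  by apply: (cE (fun t => contract (pt a) (h t))); exact: contract_cts.
apply: ctsD; last exact: cC.
apply: ctsD; last exact: cC.
apply: ctsD.
- apply: ctsM; last exact: cts_cst.
  apply: ctsM; last exact: cts_cst.
  by apply: ctsD; [exact: cts_cst|exact: ctsN].
- apply: ctsM; last exact: cts_cst.
  apply: ctsM; last exact: cts_cst.
  by apply: ctsD => //; exact: cts_cst.
Qed.

(** Each bracket in [stretch] is zero until its contraction time becomes positive. The sum thus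
    covers the edge and the tracks of both endpoints without a case split in the continuity
    proof. *)
Lemma stretch_in i (r : R) : -1 <= r <= 1 ->
  stretch i r = fun x => (1 - (1 + r) / 2) * pt (e i).1 x + (1 + r) / 2 * pt (e i).2 x.
Proof.
move=> /andP[r0 r1]; apply/funext => x; rewrite /stretch !contract0; try lra.
by rewrite /clpm min_r ?max_r//; lra.
Qed.

Lemma stretch_hi i (r : R) : 1 <= r -> stretch i r = contract (pt (e i).2) (r - 1).
Proof.
move=> r1; apply/funext => x; rewrite /stretch (@contract0 (pt (e i).1)); try lra.
by rewrite /clpm min_l ?max_r//; lra.
Qed.

Lemma stretch_lo i (r : R) : r <= -1 -> stretch i r = contract (pt (e i).1) (- r - 1).
Proof.
move=> r1; apply/funext => x; rewrite /stretch (@contract0 (pt (e i).2)); try lra.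
by rewrite /clpm min_r ?max_l//; lra.
Qed.

Lemma stretch_graph i (r : R) : graph_set (stretch i r).
Proof.
have [r0|r0] := leP r (-1).
  by exists None; rewrite stretch_lo//; exact/contract_tree/pt_tree.
have [r1|r1] := leP 1 r.
  by exists None; rewrite stretch_hi//; exact/contract_tree/pt_tree.
exists (Some i); rewrite stretch_in; last lra.
apply: seg_convex; [lra|exact: pt_seg|by rewrite segC; exact: pt_seg].
Qed.

Definition height i (g : E) : R := g (e i).2 - g (e i).1.

Lemma height_cts i : continuous (height i).
Proof. by apply: ctsD; [|apply: ctsN]; exact: cts_coordE. Qed.

Lemma seg_height i g : seg (e i).1 (e i).2 g ->
  -1 <= height i g <= 1 /\ stretch i (height i g) = g.
Proof.
move=> gs; have [gE g1] := seg_pair (e_loopless i) gs.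
have [g0 _ _] := gs; have := g0 (e i).1; have := g0 (e i).2 => h1 h2.
have h : -1 <= height i g <= 1 by rewrite /height; lra.
split=> //; rewrite stretch_in//; apply/funext => x.
rewrite [RHS](congr1 (@^~ x) gE).
by congr (_ * _ + _ * _); rewrite /height; lra.
Qed.

Lemma height_pt i : height i (pt (e i).1) = -1 /\ height i (pt (e i).2) = 1.
Proof.
have nE : ((e i).2 == (e i).1) = false by rewrite eq_sym (negPf (e_loopless i)).
by rewrite /height /pt !eqxx nE (negPf (e_loopless i)); split; rewrite ?sub0r ?subr0.
Qed.

Lemma height_stretch i (r : R) : -1 <= r <= 1 -> height i (stretch i r) = r.
Proof.
have nE : ((e i).2 == (e i).1) = false by rewrite eq_sym (negPf (e_loopless i)).
by move=> h; rewrite stretch_in// /height /pt !eqxx nE (negPf (e_loopless i)) !(mulr1, mulr0); lra.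
Qed.

Lemma graph_overlap i g (o : option 'I_N) : o != Some i ->
  seg (e i).1 (e i).2 g ->
  (if o is Some j then seg (e j).1 (e j).2 g else tree_set g) ->
  g = pt (e i).1 \/ g = pt (e i).2.
Proof.
case: o => [j|] ij gs; last first.
  move=> [[v w] /= [vw gs']]; exact: seg_cross (e_loopless i) (tree_e _ vw) gs gs'.
move=> gs'; apply: seg_cross (e_loopless i) _ gs gs'.
by apply: e_inj; apply: contra_neq ij => ->.
Qed.

Local Notation G := (set_type graph_set).
Local Notation B := (bouquet R N).
Local Notation lift i := (@wedge_lift _ _ (fun _ : 'I_N => circle_base R) i).

Let piece (o : option 'I_N) : set G :=
  [set g | if o is Some i then seg (e i).1 (e i).2 (set_val g) else tree_set (set_val g)].

Let closed_piece o : closed (piece o).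
Proof.
case: o => [i|].
- apply: (@closed_comp G E set_val (seg (e i).1 (e i).2)); last exact: closed_seg.
  by move=> x _; exact: cts_val.
- apply: (@closed_comp G E set_val tree_set); last exact: closed_tree_set.
  by move=> x _; exact: cts_val.
Qed.

Let piece_cover g : exists o, piece o g.
Proof. exact: (set_type_mem g). Qed.

Lemma lift_base (i j : 'I_N) : lift i (circle_base R) = lift j (circle_base R).
Proof. by apply: (@wedge_liftE _ _ (fun _ : 'I_N => circle_base R) j (circle_base R) i (circle_base R)). Qed.

Lemma bouquet_ind (x : B) : exists i r, -1 <= r <= 1 /\ x = lift i (loop r).
Proof.
have : [set: B] x by [].
rewrite -wedgeTE => -[i _ [c _ <-]].
by have [r h <-] := loop_surj c; exists i, r.
Qed.

(** Well defined, since a point common to a non-tree edge and another piece is an endpoint of that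
    edge; its height is -1 or 1, and [loop] sends both to the base point. *)
Lemma collapse_graph : exists f : G -> B, [/\ continuous f,
  forall g, tree_set (set_val g) -> f g = lift (Ordinal N0) (circle_base R) &
  forall i g, seg (e i).1 (e i).2 (set_val g) ->
    f g = lift i (loop (height i (set_val g)))].
Proof.
pose F (o : option 'I_N) (g : G) : B := if o is Some i
  then lift i (loop (height i (set_val g))) else lift (Ordinal N0) (circle_base R).
have key i o g : o != Some i -> piece (Some i) g -> piece o g ->
    F (Some i) g = lift (Ordinal N0) (circle_base R).
  move=> oi gi go; have [h1 h2] := height_pt i.
  rewrite (lift_base (Ordinal N0) i).
  by case: (graph_overlap oi gi go) => gE; rewrite /F gE ?h1 ?h2 loop_base// ?lexx ?orbT.
have [||f [cf fE]] := @glue_closed _ B _ piece F closed_piece _ piece_cover.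
- case=> [i|] /=; last exact: cst_continuous.
  apply: (cts_comp (@wedge_lift_continuous _ _ _ i)).
  apply: (cts_comp cts_loop); apply: (cts_comp (@height_cts i)); exact: cts_val.
- move=> o o' g go go'; have [->//|oo'] := eqVneq o o'.
  case: o go oo' => [i|] go oo'; case: o' go' oo' => [j|] go' oo' //.
  + by rewrite (key i (Some j)) 1?eq_sym// (key j (Some i)).
  + by rewrite (key i None).
  + by rewrite (key j None).
by exists f; split=> // [g gt|i g gi]; [rewrite (fE None)|rewrite (fE (Some i))].
Qed.

(** The factor 2 makes each circle run from the root along a contraction track to one endpoint,
    across the edge, and back from the other endpoint. At [r = -1] and [r = 1] the contraction time
    is 1, so all circles start and end at [pt root]. *)
Lemma spread_bouquet : exists h : B -> G, continuous h /\
  forall i r, -1 <= r <= 1 -> set_val (h (lift i (loop r))) = stretch i (2 * r).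
Proof.
have st2 (v : V) (t : R) : 1 <= t -> contract (pt v) t = pt root.
  by move=> t1; apply: (@contract1 v v) => //; exact: pt_seg.
pose F i (p : R * R) : G := to_sub (stretch_graph i) (2 * p.1).
have /choice[Th ThP] i : exists Th : R * circle R -> G, continuous Th /\
    forall w r, -1 <= r <= 1 -> Th (w, loop r) = F i (r, w).
  apply: circle_factor.
    apply: cts_sub; apply: stretch_cts; apply: ctsM; first exact: cts_cst.
    exact: cts_fst.
  move=> w; apply: set_val_inj; rewrite !to_subE /= stretch_hi ?stretch_lo ?st2 //; lra.
have base : loop 1 = circle_base R :> circle R by rewrite loop_base// lexx orbT.
have h1 : -1 <= (1 : R) <= 1 by lra.
have agree i j : Th i (0, circle_base R) = Th j (0, circle_base R).
  rewrite -base !(ThP _).2//; apply: set_val_inj; rewrite !to_subE /=.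
  by rewrite !stretch_hi ?st2//; lra.
exists (wedge_fun (fun i c => Th i (0, c))); split.
  apply: wedge_fun_continuous => // i.
  apply: (cts_comp (ThP i).1); apply: cts_pair; first exact: cst_continuous.
  by move=> x.
move=> i r rr; rewrite wedge_lift_funE//.
by rewrite (ThP i).2.
Qed.

Lemma graph_bouquet : homotopy_equivalent R G B.
Proof.
have [f [cf fT fS]] := collapse_graph; have [h [ch hE]] := spread_bouquet.
exists f, h; split=> //; apply: homotopic_sym.
- pose W := (G * unit_interval R)%type.
  (* Homotopy extension by an explicit formula: at time [t] the edge is stretched by [1 + t], so its
     endpoints, at heights -1 and 1, follow the contraction of the tree at exactly time [t]. *)
  pose F (o : option 'I_N) (p : W) : E := if o is Some i
    then stretch i ((1 + set_val p.2) * height i (set_val p.1))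
    else contract (set_val p.1) (set_val p.2).
  have c1 : continuous (fun p : W => set_val p.1 : E).
    by apply: (cts_comp (@cts_val _ _)); exact: cts_fst.
  have c2 : continuous (fun p : W => set_val p.2 : R).
    by apply: (cts_comp (@cts_val _ _)); exact: cts_snd.
  have key i o p : o != Some i -> piece (Some i) p.1 -> piece o p.1 ->
      F (Some i) p = contract (set_val p.1) (set_val p.2).
    move=> oi gi go; have [h1 h2] := height_pt i.
    have /andP[t0 t1] := unit_intervalP p.2.
    case: (graph_overlap oi gi go) => gE; rewrite /F gE ?h1 ?h2.
    + by rewrite stretch_lo; last lra; congr contract; lra.
    + by rewrite stretch_hi; last lra; congr contract; lra.
  have [||||H [cH HE]] := @glue_closed W E _ (fun o => [set p | piece o p.1]) F.
  + move=> o; apply: (@closed_comp W G fst (piece o)); last exact: closed_piece.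
    by move=> x _; exact: cts_fst.
  + case=> [i|] /=; last exact: contract_cts.
    apply: stretch_cts; apply: ctsM; first by apply: ctsD => //; exact: cts_cst.
    exact: (cts_comp (@height_cts i) c1).
  + by move=> p; exact: piece_cover.
  + move=> o o' p go go'; have [->//|oo'] := eqVneq o o'.
    case: o go oo' => [i|] go oo'; case: o' go' oo' => [j|] go' oo' //.
    * by rewrite (key i (Some j)) 1?eq_sym// (key j (Some i)).
    * by rewrite (key i None).
    * by rewrite (key j None).
  have HG p : graph_set (H p).
    have [k go] := piece_cover p.1; rewrite (HE k)//.
    case: k go => [i|] go; first exact: stretch_graph.
    by exists None; exact: contract_tree.
  exists (to_sub HG); split; first exact: cts_sub.
  split=> g t tE; apply: set_val_inj; rewrite to_subE; have [k go] := piece_cover g;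
    rewrite (HE k)// /F /= tE; case: k go => [i|] go.
  + by have [_ gE] := seg_height go; rewrite -[RHS]gE; congr stretch; lra.
  + by rewrite contract0.
  + have [rr _] := seg_height go.
    by rewrite (fS i)// hE.
  + have [[v w] /= [vw gs]] := go; rewrite (contract1 gs)//.
    have b : lift (Ordinal N0) (circle_base R) = lift (Ordinal N0) (loop 1).
      by congr (lift _ _); rewrite loop_base// lexx orbT.
    rewrite (fT _ go) b hE; last lra.
    rewrite stretch_hi; last lra.
    by rewrite (contract1 (pt_seg _ (e (Ordinal N0)).2))//; lra.
(* The composite is [loop (2 * r)] on each circle. Scaling by factors between 1 and 2 joins it to
   the identity, and the ends stay at the base point because [loop] is constant outside of
   [-1, 1]. *)
- pose F i (p : R * unit_interval R) : B := lift i (loop ((1 + set_val p.2) * p.1)).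
  have /choice[Th ThP] i : exists Th : unit_interval R * circle R -> B, continuous Th /\
      forall w r, -1 <= r <= 1 -> Th (w, loop r) = F i (r, w).
    apply: circle_factor.
      apply: (cts_comp (@wedge_lift_continuous _ _ _ i)).
      apply: (cts_comp cts_loop); apply: ctsM; last exact: cts_fst.
      apply: ctsD; first exact: cts_cst.
      by apply: (cts_comp (@cts_val _ _)); exact: cts_snd.
    move=> w; have := unit_intervalP w => hw; congr (lift i _).
    by rewrite /= !loop_base//; apply/orP; [left|right]; lra.
  have base : loop 1 = circle_base R :> circle R by rewrite loop_base// lexx orbT.
  have h1 : -1 <= (1 : R) <= 1 by lra.
  have agree t i j : Th i (t, circle_base R) = Th j (t, circle_base R).
    have := unit_intervalP t => ht.
    have b k : Th k (t, circle_base R) = lift k (circle_base R).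
      transitivity (Th k (t, loop 1)); first by congr (Th k (t, _)).
      by rewrite (ThP k).2// /F /= mulr1; congr (lift k _); apply: loop_base; apply/orP; right; lra.
    by rewrite !b; exact: lift_base.
  pose J (p : B * unit_interval R) := wedge_fun (fun i c => Th i (p.2, c)) p.1.
  exists J; split.
    pose k (i : 'I_N) (t : unit_interval R) (c : circle R) : B := Th i (t, c).
    have cU : continuous (uncurry (fun t => @wedge_fun _ _ (fun _ : 'I_N => circle_base R) B (k^~ t))).
      apply: wedge_fun_joint_continuous.
      - exact: finite_finset.
      - by move=> _; exact: closed_circle_base.
      - exact: agree.
      - move=> i; rewrite (_ : uncurry _ = Th i); first exact: (ThP i).1.
        by apply/funext => -[].
    exact: (cts_comp cU (cts_pair (@cts_snd _ _) (@cts_fst _ _))).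
  split=> x t tE; have [i [r [rr ->]]] := bouquet_ind x;
    rewrite /J wedge_lift_funE// (ThP i).2// /F /= tE.
  + by rewrite addr0 mul1r.
  + have hE' := hE i r rr; set y := h _ in hE' *.
    have -> : (1 + 1 = 2 :> R) by lra.
    have [r0|r0] := leP (2 * r) (-1).
      rewrite fT; last by rewrite hE' stretch_lo//; exact/contract_tree/pt_tree.
      by rewrite (lift_base _ i); congr (lift i _); rewrite loop_base ?r0.
    have [r1|r1] := leP 1 (2 * r).
      rewrite fT; last by rewrite hE' stretch_hi//; exact/contract_tree/pt_tree.
      by rewrite (lift_base _ i); congr (lift i _); rewrite loop_base ?r1 ?orbT.
    have r2 : -1 <= 2 * r <= 1 by lra.
    rewrite (fS i) hE' ?height_stretch// stretch_in//.
    by apply: seg_convex; [lra|exact: pt_seg|rewrite segC; exact: pt_seg].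
Qed.

End GraphBouquet.

(** * The crown graph *)

Definition crown_set (R : realType) (n : nat) :
    set (prod_topology (fun _ : bool * 'I_n => (R : Type))) :=
  [set g | exists p : 'I_n * 'I_n,
     p.1 != p.2 /\ seg (false, p.1) (true, p.2) g].

Section Crown.
Context {R : realType} (m : nat).
Local Notation n := m.+3.
Let o0 : 'I_n := @Ordinal n 0 isT.
Let o1 : 'I_n := @Ordinal n 1 isT.
Let o2 : 'I_n := @Ordinal n 2 isT.

(** A neighbour of (false, j) other than (true, 0). The matching edge is missing, so for j = 1 a
    third index has to be taken. *)
Definition crown_parent (j : 'I_n) := if j == o1 then o2 else o1.

(* A spanning tree rooted at (false, 0), of depth three: below the root all
   (true, i) with i != 0, below them all (false, j) with j != 0, and (true, 0)
   below (false, 1). *)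
Definition crown_tree (p : 'I_n * 'I_n) := (p.1 != p.2) &&
  [|| p.1 == o0, p.2 == crown_parent p.1 | (p.1 == o1) && (p.2 == o0)].

Definition crown_nontree := [set p : 'I_n * 'I_n | (p.1 != p.2) && ~~ crown_tree p]%SET.

(** Counting by first index: row 0 lies in the tree, row 1 leaves n - 3 edges, each of the other n -
    2 rows leaves n - 2, and (n - 3) + (n - 2)^2 is the claimed number. *)
Lemma card_crown_nontree : #|crown_nontree| = (n ^ 2 - 3 * n + 1)%N.
Proof.
have -> : #|crown_nontree| =
    (\sum_(j < n) #|[set i | (j, i) \in crown_nontree]%SET|)%N.
  rewrite -sum1_card (eq_bigl (fun p : 'I_n * 'I_n => xpredT p.1 && ((p.1, p.2) \in crown_nontree))); last by case.
  rewrite -(pair_big_dep xpredT (fun j i => (j, i) \in crown_nontree) (fun _ _ => 1%N)) /=.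
  by apply: eq_bigr => j _; rewrite -sum1_card; apply: eq_bigl => i; rewrite inE.
have F0 : #|[set i | (o0, i) \in crown_nontree]%SET| = 0%N.
  apply: eq_card0 => i; rewrite !inE /crown_tree eqxx /= andbT.
  by rewrite andbN.
have F1 : #|[set i | (o1, i) \in crown_nontree]%SET| = m.
  have -> : [set i | (o1, i) \in crown_nontree]%SET = (~: [set o0; o1; o2])%SET.
    apply/setP => i; rewrite !inE /crown_tree /crown_parent eqxx /= (eq_sym o1 i).
    by case: (i == o0); case: (i == o1); case: (i == o2).
  apply/eqP; rewrite -(eqn_add2l #|[set o0; o1; o2]%SET|) cardsC card_ord.
  by rewrite finset.setUC cardsU1 cards2 !inE.
have F2 (j : 'I_n) : (1 < j)%N -> #|[set i | (j, i) \in crown_nontree]%SET| = m.+1.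
  move=> j1; have j0' : j != o0 by apply: contraTneq j1 => ->.
  have j1' : j != o1 by apply: contraTneq j1 => ->.
  have -> : [set i | (j, i) \in crown_nontree]%SET = (~: [set j; o1])%SET.
    apply/setP => i; rewrite !inE /= /crown_tree /crown_parent /= (negPf j0') (negPf j1').
    by rewrite /= orbF (eq_sym j i); case: (i == j); case: (i == o1).
  apply/eqP; rewrite -(eqn_add2l #|[set j; o1]%SET|) cardsC card_ord cards2 j1'.
  by [].
rewrite 2!big_ord_recl.
rewrite [X in (X + _)%N](_ : _ = 0%N); last by rewrite -F0; apply: eq_card => i; rewrite !inE.
rewrite [X in (_ + (X + _))%N](_ : _ = m); last first.
  by rewrite -[RHS]F1; congr #|pred_of_set _|; apply/setP => i; rewrite !inE; congr (_ && _);
     rewrite ?(_ : lift ord0 ord0 = o1)//; apply: val_inj.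
rewrite (eq_bigr (fun=> m.+1)); last by move=> j _; apply: F2.
rewrite sum_nat_const card_ord.
by rewrite add0n -mulnn !mulSn !mulnS; lia.
Qed.

Definition crown_rel : rel (bool * 'I_n) := fun v w =>
  (v.1 != w.1) && crown_tree (if v.1 then (w.2, v.2) else (v.2, w.2)).


(** The tree is shortened from its leaves: first the only vertex of depth three moves to its parent,
    then depth two moves to depth one. [crown_phi2] sends (true, 0) to the new place (true, 2) of
    that parent, which keeps the two maps contiguous. *)
Definition crown_phi1 (v : bool * 'I_n) := if v == (true, o0) then (false, o1) else v.
Definition crown_phi2 (v : bool * 'I_n) :=
  if v == (true, o0) then (true, o2)
  else if v.1 || (v.2 == o0) then v else (true, crown_parent v.2).

Lemma crown_parent_neq j : crown_parent j != j /\ crown_parent j != o0.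
Proof. by rewrite /crown_parent; case: (eqVneq j o1) => [->//|]; rewrite eq_sym. Qed.

Lemma contiguous_sym (f h : bool * 'I_n -> bool * 'I_n) :
  (forall j i, crown_tree (j, i) -> exists a b, crown_rel a b /\
     all (mem [:: a; b]) [:: f (false, j); f (true, i); h (false, j); h (true, i)]) ->
  contiguous crown_rel f h.
Proof.
move=> H [[] v] [[] w] //; rewrite /crown_rel /= => /H[a [b [ab]]] /=.
- by move=> /and5P[h1 h2 h3 h4 _]; exists a, b; split=> //; rewrite h1 h2 h3 h4.
- by move=> /and5P[h1 h2 h3 h4 _]; exists a, b; split=> //; rewrite h1 h2 h3 h4.
Qed.

Lemma crown_treeP j i : crown_tree (j, i) ->
  [\/ j = o0 /\ i != o0, j != o0 /\ i = crown_parent j | j = o1 /\ i = o0].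
Proof.
rewrite /crown_tree /= => /andP[ji]; case: (eqVneq j o0) ji => [-> i0 _|j0 _ /=].
  by constructor 1; rewrite eq_sym.
by move=> /orP[/eqP->|/andP[/eqP-> /eqP->]]; [constructor 2|constructor 3].
Qed.

Lemma crown_tree_root i : i != o0 -> crown_tree (o0, i).
Proof. by move=> i0; rewrite /crown_tree /= eq_sym i0. Qed.

Lemma crown_tree_parent j : crown_tree (j, crown_parent j).
Proof.
by have [h _] := crown_parent_neq j; rewrite /crown_tree /= eq_sym h eqxx orbT.
Qed.

Lemma crown_bouquet :
  homotopy_equivalent R (set_type (@crown_set R n)) (bouquet R (n ^ 2 - 3 * n + 1)).
Proof.
rewrite -card_crown_nontree.
pose ev (i : 'I_#|crown_nontree|) : 'I_n * 'I_n := enum_val i.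
pose e (i : 'I_#|crown_nontree|) : (bool * 'I_n) * (bool * 'I_n) :=
  ((false, (ev i).1), (true, (ev i).2)).
have eP i : ev i \in crown_nontree by exact: enum_valP.
have nt_tree p : p.1 != p.2 -> p \notin crown_nontree -> crown_tree p.
  by move=> pp; rewrite inE pp /= negbK.
have -> : @crown_set R n = graph_set e crown_rel.
  apply/seteqP; split=> g.
  - move=> [p [pp gs]]; have [pn|pn] := boolP (p \in crown_nontree).
      by exists (Some (enum_rank_in pn p)); rewrite /e /ev /= enum_rankK_in.
    exists None; exists ((false, p.1), (true, p.2)); split=> //=.
    by rewrite /crown_rel /=; case: p pp pn {gs} => a b /= pp pn; exact: nt_tree.
  - move=> [[i|]] /=.
      by move=> gs; exists (ev i); split=> //; have := eP i; rewrite inE => /andP[].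
    move=> [[[[] v] [[] w]]] /= [] //; rewrite /crown_rel /= => vw gs.
      by exists (w, v); split; [case/andP: vw|rewrite segC].
    by exists (v, w); split=> //; case/andP: vw.
apply: (@graph_bouquet R _ _ e crown_rel crown_phi1 crown_phi2 (false, o0)).
- by rewrite card_crown_nontree addn1.
- by move=> i.
- move=> [[] v] [[] w] i; rewrite /crown_rel //= => vw; apply/negP => /=;
    rewrite !inE !xpair_eqE /= ?orbF => /andP[/eqP h1 /eqP h2];
    by have := eP i; rewrite inE => /andP[_]; case: (ev i) h1 h2 => a b /= -> ->; rewrite vw.
- move=> i j ij; apply/negP; rewrite !inE !xpair_eqE /= ?orbF => /andP[/eqP h1 /eqP h2];
  have E : ev i = ev j by case: (ev i) h1 h2 => a b /= -> ->; case: (ev j).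
  by move/eqP: ij; apply; exact: enum_val_inj E.
- move=> [[] v].
    have [->|v0] := eqVneq v o0; first by exists (false, o1).
    by exists (false, o0); rewrite /crown_rel /= crown_tree_root.
  have [->|v0] := eqVneq v o0; first by exists (true, o1).
  by exists (true, crown_parent v); rewrite /crown_rel /= crown_tree_parent.
- apply: contiguous_sym => j i ji; exists (false, j), (true, i); split=> //.
  rewrite /crown_phi1 /= !inE !eqxx !orbT /= andbT /=.
  case: ifP => [/eqP[i0]|_]; last by rewrite eqxx orbT.
  by case/crown_treeP: ji => [[_]|[_]|[-> _]]; rewrite ?i0 ?eqxx// => /esym/eqP; rewrite (negPf (crown_parent_neq j).2).
- apply: contiguous_sym => j i /crown_treeP[[-> i0]|[j0 ->]|[-> ->]].
  + exists (false, o0), (true, i); rewrite /crown_rel /= crown_tree_root//; split=> //.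
    by rewrite /crown_phi1 /crown_phi2 /= xpair_eqE /= (negPf i0) !inE !eqxx ?orbT.
  + exists (false, j), (true, crown_parent j).
    rewrite /crown_rel /= crown_tree_parent; split=> //.
    have [_ /negPf h] := crown_parent_neq j.
    by rewrite /crown_phi1 /crown_phi2 /= xpair_eqE /= h (negPf j0) !inE !eqxx ?orbT.
  + by exists (false, o1), (true, o2); rewrite /crown_rel /crown_phi1 /crown_phi2.
- apply: contiguous_sym => j i /crown_treeP[[-> i0]|[j0 ->]|[-> ->]].
  + exists (false, o0), (true, i); rewrite /crown_rel /= crown_tree_root//; split=> //.
    by rewrite /crown_phi1 /crown_phi2 /= xpair_eqE /= (negPf i0) !inE !eqxx ?orbT.
  + have [_ h] := crown_parent_neq j.
    exists (false, o0), (true, crown_parent j); rewrite /crown_rel /= crown_tree_root//; split=> //.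
    by rewrite /crown_phi1 /crown_phi2 /= xpair_eqE /= (negPf h) (negPf j0) !inE !eqxx ?orbT.
  + by exists (false, o0), (true, o2); rewrite /crown_rel /crown_phi1 /crown_phi2.
Qed.

End Crown.

(** * Two basins *)

Section Basins.
Context {R : realType} {V : finType} (adj : rel V) (z : V -> R).
Hypothesis adjC : symmetric adj.

(** The geometric content of the diagram. Joining every vertex to one of the two minima at its own
    height rules out further births; the last two clauses fix the death at exactly 4. *)
Definition two_basins (u w : V) := [/\ z u = 0, z w = 1,
  forall v, connect (sub_edge adj z (z v)) v u \/ connect (sub_edge adj z (z v)) v w,
  connect (sub_edge adj z 4) u w &
  forall s, s < 4 -> ~~ connect (sub_edge adj z s) u w].

Let comp (s : R) v := [set w | connect (sub_edge adj z s) v w]%SET.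

Lemma sub_edgeC s : connect_sym (sub_edge adj z s).
Proof.
apply: sym_connect_sym => u w; rewrite /sub_edge adjC; congr (_ && _).
by rewrite maxC.
Qed.

Lemma sub_edgeS s s' : s <= s' -> subrel (connect (sub_edge adj z s)) (connect (sub_edge adj z s')).
Proof.
move=> ss'; apply: connect_sub => u w /andP[uw h]; apply: connect1.
by rewrite /sub_edge uw (le_trans h).
Qed.

Let compE s v v' : (comp s v == comp s v') = connect (sub_edge adj z s) v v'.
Proof.
apply/eqP/idP => [E|c].
  have : v' \in comp s v' by rewrite inE connect0.
  by rewrite -E inE.
apply/setP => x; rewrite !inE; exact: (same_connect (@sub_edgeC s) c).
Qed.

(** [connect] is reflexive even at a vertex above level [s]; the first alternative accounts for this
    empty path. *)
Lemma connect_le s v u : connect (sub_edge adj z s) v u -> v = u \/ z v <= s /\ z u <= s.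
Proof.
move=> /connectP[[|x p] /= vp ->]; first by left.
right; split; first by case/andP: vp => /andP[_]; rewrite ge_max => /andP[].
have : path (sub_edge adj z s) v (x :: p) by [].
rewrite (lastI x p) rcons_path => /andP[_ /andP[_]].
by rewrite ge_max => /andP[_].
Qed.

Lemma ph0_rankE r s : ph0_rank adj z r s = #|(comp s) @: [set v | z v <= r]%SET|.
Proof. by []. Qed.

Lemma count_diagP (r s : R) :
  count (fun p => (p.1 <= r) && (s%:E < p.2)%E) (diagP R) =
  ((0 <= r)%R + ((1 <= r)%R && (s < 4)%R))%N.
Proof. by rewrite /= ltry andbT lte_fin addn0. Qed.

(** A component counted by the rank is that of [u] or of [w]. The one of [w] enters once [1 <= r],
    and the two coincide exactly when [4 <= s]. *)
Lemma two_basins_PH0 u w : two_basins u w -> PH0_is adj z (diagP R).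
Proof.
move=> [zu zw vuw uw4 uwN4]; split.
  by rewrite /diagP /= ltry lte_fin ltr1n.
have wle v : connect (sub_edge adj z (z v)) v w -> 1 <= z v.
  by move=> /connect_le[->|[_]]; rewrite ?zw.
have z0 v : 0 <= z v.
  by case: (vuw v) => [/connect_le[->|[_]]|/wle]; rewrite ?zu// => /(le_trans ler01).
move=> r s rs; rewrite count_diagP ph0_rankE.
have comps v : z v <= r -> comp s v = comp s u \/ 1 <= r /\ comp s v = comp s w.
  move=> vr; case: (vuw v) => [c|c]; [left|right].
    by apply/eqP; rewrite compE; apply: (sub_edgeS (le_trans vr rs)).
  split; first exact: le_trans (wle _ c) vr.
  by apply/eqP; rewrite compE; apply: (sub_edgeS (le_trans vr rs)).
have [r0|r0] := leP 0 r; last first.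
  rewrite [1 <= r]lt_geF; last lra.
  by rewrite (_ : [set v | _]%SET = finset.set0) ?imset0 ?cards0//; apply/setP => v; rewrite !inE lt_geF// (lt_le_trans r0).
have ur : comp s u \in (comp s) @: [set v | z v <= r]%SET by apply: imset_f; rewrite inE zu.
have [r1|r1] := leP 1 r; last first.
  rewrite /= addn0 (_ : imset _ _ = [set comp s u]%SET) ?cards1//.
  apply/eqP; rewrite finset.eqEsubset finset.sub1set ur andbT; apply/fintype.subsetP => x /imsetP[v].
  by rewrite !inE => vr ->; case: (comps v vr) => [->//|[r1' _]]; exfalso; lra.
have wr : comp s w \in (comp s) @: [set v | z v <= r]%SET by apply: imset_f; rewrite inE zw.
rewrite (_ : imset _ _ = [set comp s u; comp s w]%SET); last first.
  apply/eqP; rewrite finset.eqEsubset finset.subUset !finset.sub1set ur wr /= andbT; apply/fintype.subsetP => x /imsetP[v].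
  by rewrite !inE => vr ->; case: (comps v vr) => [->|[_ ->]]; rewrite eqxx ?orbT.
rewrite cards2 compE add1n /=; congr _.+1.
by have [s4|s4] := ltP s 4; [rewrite uwN4|rewrite (sub_edgeS s4 uw4)].
Qed.

(** Ranks equal to one give connections, ranks equal to two give separations. [u] is found at level
    0 and [w] in the second component at level 1; its height is 1 because all vertices below 1 are
    connected to each other at level 1. *)
Lemma PH0_two_basins : PH0_is adj z (diagP R) -> exists u w, two_basins u w.
Proof.
move=> [_ H].
have {}H r s : r <= s -> #|(comp s) @: [set v | z v <= r]%SET| =
    ((0 <= r)%R + ((1 <= r)%R && (s < 4)%R))%N.
  by move=> rs; rewrite -count_diagP -H.
have inC r s v : z v <= r -> comp s v \in (comp s) @: [set v | z v <= r]%SET.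
  by move=> vr; apply: imset_f; rewrite inE.
have z0 v : 0 <= z v.
  rewrite leNgt; apply/negP => v0; have := H (z v) (z v) (lexx _).
  rewrite [0 <= _]lt_geF// [1 <= _]lt_geF; last lra.
  by move=> /eqP; rewrite cards_eq0 => /eqP E; have := inC (z v) (z v) v (lexx _); rewrite E inE.
have one r s v v' : r <= s -> (r < 1) || (4 <= s) -> z v <= r -> z v' <= r ->
    connect (sub_edge adj z s) v v'.
  move=> rs r1 vr v'r; rewrite -compE; apply/eqP.
  have : #|(comp s) @: [set v | z v <= r]%SET| = 1%N.
    rewrite H// (le_trans (z0 v) vr); case/orP: r1 => h.
      by rewrite [1 <= r]lt_geF.
    by rewrite [s < 4]le_gtF// andbF.
  move=> /eqP/cards1P[A EA].
  have := inC r s v vr; have := inC r s v' v'r; rewrite EA !inE => /eqP-> /eqP->.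
  by [].
have [u zu] : exists u, z u = 0.
  have : #|(comp 0) @: [set v | z v <= 0]%SET| != 0%N by rewrite H// lexx.
  rewrite cards_eq0 => /set0Pn[_ /imsetP[u + _]]; rewrite inE => h.
  by exists u; apply/le_anti; rewrite h z0.
have two s : 1 <= s -> s < 4 -> #|(comp s) @: [set v | z v <= 1]%SET| = 2%N.
  by move=> s1 s4; rewrite H// ler01 lexx s4.
have /cards2P[A [B [AB EAB]]] : #|(comp 1) @: [set v | z v <= 1]%SET| == 2%N.
  by rewrite two//; lra.
have [w w1 wu] : exists2 w, z w <= 1 & ~~ connect (sub_edge adj z 1) u w.
  have : exists2 C, C \in (comp 1) @: [set v | z v <= 1]%SET & C != comp 1 u.
    have [EA|nA] := eqVneq A (comp 1 u).
      by exists B; rewrite ?EAB ?inE ?eqxx ?orbT// -EA eq_sym.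
    by exists A; rewrite ?EAB ?inE ?eqxx.
  move=> [C /imsetP[w]]; rewrite inE => w1 -> h; exists w => //.
  by rewrite -compE eq_sym.
have zw : z w = 1.
  apply/le_anti; rewrite w1 leNgt; apply/negP => h; move/negP: wu; apply.
  by apply: (one (z w)) => //; rewrite ?h ?zu ?z0.
have low v : z v <= 1 -> comp 1 v = comp 1 u \/ comp 1 v = comp 1 w.
  move=> v1; have := inC 1 1 v v1; have := inC 1 1 w w1; have := inC 1 1 u.
  rewrite zu ler01 EAB !inE => /(_ isT) h1 h2 h3; move: wu; rewrite -compE.
  by case/orP: h1 => /eqP->; case/orP: h2 => /eqP->; case/orP: h3 => /eqP->; rewrite ?eqxx//; auto.
(* If [u] and [w] met at a level in [1, 4), all vertices of height at most 1 would lie in one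
   component there, against rank two. *)
have sep s : s < 4 -> ~~ connect (sub_edge adj z s) u w.
  move=> s4; have [s1|/ltW s1] := leP 1 s; last by apply: contra wu; exact: sub_edgeS.
  apply/negP => c; have := two s s1 s4.
  rewrite (_ : imset _ _ = [set comp s u]%SET) ?cards1//.
  apply/eqP; rewrite finset.eqEsubset finset.sub1set inC ?zu ?ler01// andbT.
  apply/fintype.subsetP => x /imsetP[v]; rewrite !inE => v1 ->; rewrite compE.
  case: (low v v1) => /eqP; rewrite compE => /(sub_edgeS s1) // h.
  by apply: connect_trans h _; rewrite sub_edgeC.
exists u, w; split=> //; last first.
  by apply: (one 4) => //; rewrite ?lexx ?orbT ?zu ?zw; lra.
move=> v; have [v1|v1] := ltP (z v) 1.
  by left; apply: (one (z v)) => //; rewrite ?v1// zu.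
have [v4|v4] := leP 4 (z v).
  by left; apply: (one (z v)) => //; rewrite ?v4 ?orbT// zu.
(* Three vertices in two components: [u] and [w] are still apart, so [v] joins one of them. *)
have : #|(comp (z v)) @: [set x | z x <= z v]%SET| == 2%N by rewrite H// z0 v1 v4.
move=> /cards2P[A' [B' [AB' E]]].
have := inC (z v) (z v) v (lexx _); have := inC (z v) (z v) u; have := inC (z v) (z v) w.
rewrite E !inE zu zw z0 v1 => /(_ isT) h1 /(_ isT) h2 h3.
have := sep _ v4; rewrite -!compE.
by case/orP: h1 => /eqP->; case/orP: h2 => /eqP->; case/orP: h3 => /eqP->; rewrite ?eqxx//; auto.
Qed.

End Basins.

(** * Detecting the lower basin by a continuous function *)

Section Bell.
Context {R : realType} {V : finType} (adj : rel V).
Hypothesis adjC : symmetric adj.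
Local Notation E := (prod_topology (fun _ : V => (R : Type))).
Implicit Type z : V -> R.

(* Bellman iteration: starting from the vertices with z < 1, which lie in the
   lower basin, the height 1 - z / 4 spreads over that basin and nowhere else. *)
Fixpoint bell (k : nat) z (v : V) : R :=
  if k is k'.+1 then
    Num.max (bell k' z v)
      (\big[Num.max/0]_(v' | adj v v') Num.min (Num.max 0 (1 - z v / 4)) (bell k' z v'))
  else Num.max 0 (1 - z v).

Lemma bell_cts k v : continuous (fun z : E => bell k z v).
Proof.
have cz x : continuous (fun z : E => z x).
  by apply: (@cts_coord R E V (fun g => g) x) => g.
elim: k v => [|k IH] v /=.
  apply: cts_max; first exact: cts_cst.
  by apply: ctsD; [exact: cts_cst|exact: ctsN].
apply: cts_max => //; apply: cts_bigmax => v' _; apply: cts_min => //.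
apply: cts_max; first exact: cts_cst.
apply: ctsD; first exact: cts_cst.
by apply: ctsN; apply: ctsM => //; exact: cts_cst.
Qed.

Lemma bell_ge0 k z v : 0 <= bell k z v.
Proof. by elim: k v => [|k IH] v /=; rewrite le_max ?lexx// IH. Qed.

Lemma bell_mono k k' z v : (k <= k')%N -> bell k z v <= bell k' z v.
Proof.
move=> /subnK <-; elim: (k' - k)%N => // d IH.
by rewrite addSn /= le_max IH.
Qed.

Variables (z : V -> R) (u w : V).
Hypothesis zuw : two_basins adj z u w.

Definition basin (v : V) := (z v < 4) && connect (sub_edge adj z (z v)) v u.
Definition basin' (v : V) := (z v < 4) && connect (sub_edge adj z (z v)) v w.

Lemma basin_cases v : [\/ basin v, basin' v | 4 <= z v].
Proof.
have [_ _ h _ _] := zuw; rewrite /basin /basin'.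
have [v4|v4] := ltP (z v) 4; last by constructor 3.
by case: (h v) => ->; [constructor 1|constructor 2].
Qed.

Lemma two_basins_ge0 v : 0 <= z v.
Proof.
have [zu zw h _ _] := zuw; case: (h v) => /connect_le.
  by move=> [->|[_]]; rewrite zu.
by move=> [->|[_]]; rewrite zw => // /(le_trans ler01).
Qed.

Lemma basin'_ge1 v : basin' v -> 1 <= z v.
Proof.
have [zu zw _ _ _] := zuw => /andP[_ /connect_le[->|[_]]]; by rewrite zw.
Qed.

(** A common or adjacent pair of vertices would connect [u] and [w] at the larger of their two
    heights, which is below 4. *)
Lemma basin_disj v v' : basin v -> basin' v' -> v = v' \/ adj v v' -> False.
Proof.
have [_ _ _ _ N4] := zuw.
move=> /andP[v4 cv] /andP[v'4 cv'] vv'.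
pose s := Num.max (z v) (z v').
have s4 : s < 4 by rewrite gt_max v4.
apply: (negP (N4 s s4)).
have vs : z v <= s by rewrite le_max lexx.
have v's : z v' <= s by rewrite le_max lexx orbT.
apply: (@connect_trans _ _ v).
  by rewrite sub_edgeC//; exact: (sub_edgeS vs).
apply: (@connect_trans _ _ v'); last exact: (sub_edgeS v's).
case: vv' => [->|vv']; first exact: connect0.
by apply: connect1; rewrite /sub_edge vv' lexx.
Qed.

(** The iteration cannot leak: the upper basin starts at height 1 and is not adjacent to the lower
    one, and the ceiling [Num.max 0 (1 - z v / 4)] is zero from height 4 on. *)
Lemma bell_le k v : bell k z v <= if basin v then 1 - z v / 4 else 0.
Proof.
have h0 := two_basins_ge0.
elim: k v => [|k IH] v /=.
  case: ifP => [/andP[v4 _]|Nb]; rewrite ge_max.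
    by apply/andP; split; have := h0 v; lra.
  rewrite lexx /=; case: (basin_cases v) => [|/basin'_ge1|]; rewrite ?Nb//; lra.
rewrite ge_max IH /=; apply: bigmax_le.
  by case: ifP => // /andP[v4 _]; lra.
move=> v' vv'; rewrite ge_min; case: ifP => [/andP[v4 _]|Nb].
  by rewrite max_r ?lexx//; lra.
case: (basin_cases v) => [|b'|v4]; rewrite ?Nb//; last by rewrite max_l ?lexx//; lra.
apply/orP; right; apply: (le_trans (IH v')); case: ifP => // b.
by case: (@basin_disj v' v b b'); right; rewrite adjC.
Qed.

Lemma bell_path (a : R) v p : 0 <= a -> path (sub_edge adj z a) v p -> last v p = u ->
  z v <= a -> 1 - a / 4 <= bell (size p) z v.
Proof.
have [zu _ _ _ _] := zuw.
move=> a0; elim: p v => [|v' p IH] v /=.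
  by move=> _ -> _; rewrite zu le_max; apply/orP; right; lra.
move=> /andP[/andP[vv']]; rewrite ge_max => /andP[va v'a] pv' lp _.
rewrite le_max; apply/orP; right.
have h := IH _ pv' lp v'a.
apply: le_trans (le_bigmax_cond _ (fun v' => Num.min (Num.max 0 (1 - z v / 4)) (bell (size p) z v')) vv').
by rewrite le_min h andbT le_max; apply/orP; right; lra.
Qed.

(** A path without repetition has fewer than [#|V|] edges, so [#|V|] rounds fill the whole basin. *)
Lemma bell_eq v : bell #|V| z v = if basin v then 1 - z v / 4 else 0.
Proof.
apply/le_anti; rewrite bell_le /=; case: ifP => [|_]; last exact: bell_ge0.
move=> /andP[v4 /connectP[p0 /shortenP[p pp up _] lp]].
have sp : (size p <= #|V|)%N.
  by have := max_card (mem (v :: p)); rewrite (card_uniqP up) /=; exact: ltnW.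
apply: le_trans (bell_mono z v sp); apply: bell_path => //; exact: two_basins_ge0.
Qed.

End Bell.

(** * Bumps on the star *)

Section Star.
Context {R : realType} {n : nat} (l : 'I_n -> nat).
Local Notation V := (starV n l).
Local Notation adj := (@star_adj n l).

(* k is the distance to the centre; k > l b gives the centre as junk value. *)
Definition vx (b : 'I_n) (k : nat) : V :=
  if k is k'.+1 then
    if insub k' is Some o then Some (existT (fun i => 'I_(l i)) b o) else None
  else None.

Lemma vx_ord b (o : 'I_(l b)) : vx b o.+1 = Some (existT _ b o).
Proof. by rewrite /= valK. Qed.

Lemma vxS b k (kb : (k < l b)%N) : vx b k.+1 = Some (existT _ b (Ordinal kb)).
Proof. by rewrite /= insubT. Qed.

Lemma vx0 b : vx b 0 = None. Proof. by []. Qed.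

Arguments vx : simpl never.

Lemma vxP (i0 : 'I_n) (v : V) : exists b k, (k <= l b)%N /\ v = vx b k.
Proof.
case: v => [[b o]|]; last by exists i0, 0%N.
by exists b, o.+1; rewrite vx_ord.
Qed.

Lemma star_adjC : symmetric adj.
Proof. by case=> [[b o]|] [[b' o']|] //=; rewrite eq_sym orbC. Qed.

Lemma adj_vx b k : (k < l b)%N -> adj (vx b k) (vx b k.+1).
Proof.
move=> kb; rewrite (vxS kb); case: k kb => [|k] kb //.
by rewrite (vxS (ltnW kb)) /= !eqxx.
Qed.

Lemma adjP (v v' : V) : adj v v' -> exists b k, (k < l b)%N /\
  ((v = vx b k /\ v' = vx b k.+1) \/ (v = vx b k.+1 /\ v' = vx b k)).
Proof.
case: v v' => [[b o]|] [[b' o']|] //=.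
- move=> /andP[/eqP/= bb']; subst b' => /orP[]/eqP h.
  + exists b, o.+1; split; first by rewrite h.
    by left; split; [rewrite vx_ord|rewrite h vx_ord].
  + exists b, o'.+1; split; first by rewrite h.
    by right; split; [rewrite h vx_ord|rewrite vx_ord].
- move=> /eqP h; exists b, 0%N; split; first by rewrite -h.
  by right; have := vx_ord o; rewrite h vx0 => ->.
- move=> /eqP h; exists b', 0%N; split; first by rewrite -h.
  by left; have := vx_ord o'; rewrite h vx0 => ->.
Qed.

Definition beyond (b : 'I_n) (k : nat) (v : V) :=
  if v is Some t then (tag t == b) && (k <= (tagged t).+1)%N else false.

Lemma beyond_vx b k b' k' : (0 < k)%N -> (k' <= l b')%N ->
  beyond b k (vx b' k') = (b' == b) && (k <= k')%N.
Proof.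
move=> k0; case: k' => [|k'] kb; first by rewrite vx0 /= leqNgt k0 andbF.
by rewrite (vxS kb).
Qed.

(** The part of branch [b] from distance [k] on hangs on the rest of the star by a single edge, so
    every path that leaves this part uses it. *)
Lemma connect_cut (e : rel V) b k v u : subrel e adj -> (0 < k)%N ->
  connect e v u -> beyond b k v -> ~~ beyond b k u -> e (vx b k) (vx b k.-1).
Proof.
move=> eadj k0 /connectP[p pp ->] {u}; elim: p v pp => [|x p IH] v /=.
  by move=> _ ->.
move=> /andP[vx' xp] bv; have [bx|nbx] := boolP (beyond b k x); first exact: IH.
move=> _; have [b' [k' [kb [[ev ex]|[ev ex]]]]] := adjP (eadj _ _ vx').
- move: bv nbx; rewrite ev ex !beyond_vx ?(ltnW kb)// => /andP[-> /leqW->].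
  by [].
- move: vx' bv nbx; rewrite ev ex !beyond_vx ?(ltnW kb)// => vx' /andP[/eqP bb kk].
  rewrite bb eqxx /= -ltnNge => kk'.
  have -> : k = k'.+1 by lia.
  by rewrite -bb.
Qed.

Lemma connect_branch (e : rel V) b k1 k2 : (k1 <= k2)%N ->
  (forall k, (k1 <= k < k2)%N -> e (vx b k) (vx b k.+1)) ->
  connect e (vx b k1) (vx b k2).
Proof.
move=> /subnK <-; elim: (k2 - k1)%N => [|d IH] h; first exact: connect0.
apply: connect_trans (IH _) (connect1 _).
  by move=> k hk; apply: h; lia.
by rewrite addSn; apply: h; lia.
Qed.

(** [K = 0] puts the peak at the centre, whichever [i] is named. A flat top admits several pairs
    [i], [K], a freedom used when one straight line is followed by another. *)
Definition isbump (x : V -> R) (i : 'I_n) (K : nat) :=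
  [/\ (K <= l i)%N, forall v, 0 <= x v, x (vx i K) = 1,
    forall b k, (k < l b)%N -> (b != i) || (K <= k)%N -> x (vx b k.+1) <= x (vx b k) &
    forall k, (k < K)%N -> x (vx i k) <= x (vx i k.+1)].

Lemma bump_dec x i K b k1 k2 : isbump x i K -> (k1 <= k2 <= l b)%N ->
  (b != i) || (K <= k1)%N -> x (vx b k2) <= x (vx b k1).
Proof.
move=> [_ _ _ h _] /andP[/subnK <-]; elim: (k2 - k1)%N => // d IH kl bK.
rewrite addSn in kl *; apply: le_trans (h _ _ kl _) (IH (ltnW kl) bK).
by case/orP: bK => [->//|kK]; apply/orP; right; lia.
Qed.

Lemma bump_inc x i K k1 k2 : isbump x i K -> (k1 <= k2 <= K)%N ->
  x (vx i k1) <= x (vx i k2).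
Proof.
move=> [_ _ _ _ h] /andP[/subnK <-]; elim: (k2 - k1)%N => // d IH kl.
by rewrite addSn in kl *; apply: le_trans (IH (ltnW kl)) (h _ kl).
Qed.

Lemma bump_centre x i K b k : isbump x i K -> b != i -> (k <= l b)%N ->
  x (vx b k) <= x None.
Proof. by move=> bx bi kb; apply: (bump_dec (k1 := 0%N) bx); rewrite ?bi. Qed.

Lemma bump_le1 x i K v : isbump x i K -> x v <= 1.
Proof.
move=> bx; have [Kl _ <- _ _] := bx; have [b [k [kb ->]]] := vxP i v.
have [bi|bi] := eqVneq b i; last first.
  apply: le_trans (bump_centre bx bi kb) _.
  by apply: (bump_inc (k1 := 0%N) bx); rewrite leqnn.
subst b; have [kK|/ltnW Kk] := leqP k K.
  by apply: (bump_inc bx); rewrite kK leqnn.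
by apply: (bump_dec bx); rewrite ?Kk ?leqnn ?orbT.
Qed.

Lemma bump_mid x i K b k1 k2 k3 : isbump x i K -> (k1 <= k2 <= k3)%N -> (k3 <= l b)%N ->
  Num.min (x (vx b k1)) (x (vx b k3)) <= x (vx b k2).
Proof.
move=> bx /andP[h1 h2] h3; rewrite ge_min; apply/orP.
have [bi|bi] := eqVneq b i; last first.
  by right; apply: (bump_dec bx); rewrite ?h2 ?bi.
subst b; have [kK|/ltnW Kk] := leqP k2 K.
  by left; apply: (bump_inc bx); rewrite h1.
by right; apply: (bump_dec bx); rewrite ?h2 ?Kk ?orbT.
Qed.

Definition super_edge (x : V -> R) (a : R) : rel V :=
  fun v v' => [&& adj v v', a <= x v & a <= x v'].

(** Connected superlevel sets force unimodality: the path from a positive vertex to the peak must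
    cross the edge towards the peak without dropping below the starting value. *)
Lemma connect_bump x i K : (K <= l i)%N -> (forall v, 0 <= x v) -> x (vx i K) = 1 ->
  (forall v, 0 < x v -> connect (super_edge x (x v)) v (vx i K)) -> isbump x i K.
Proof.
move=> Kl x0 x1 h; split=> // [b k kb bK|k kK].
- have [xp|] := ltP 0 (x (vx b k.+1)); last by move/le_trans; apply.
  have /h c := xp.
  suff /and3P[] : super_edge x (x (vx b k.+1)) (vx b k.+1) (vx b k.+1.-1) by [].
  apply: connect_cut c _ _ => //.
  + by move=> ? ? /and3P[].
  + by rewrite beyond_vx// eqxx leqnn.
  + by rewrite beyond_vx// negb_and -ltnNge ltnS eq_sym.
- have [xp|] := ltP 0 (x (vx i k)); last by move/le_trans; apply.
  have /h := xp; rewrite sym_connect_sym; last first.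
    by move=> a b; rewrite /super_edge star_adjC; congr (_ && _); rewrite andbC.
  move=> c; suff /and3P[] : super_edge x (x (vx i k)) (vx i k.+1) (vx i k.+1.-1) by [].
  apply: connect_cut c _ _ => //.
  + by move=> ? ? /and3P[].
  + by rewrite beyond_vx// eqxx kK.
  + by rewrite beyond_vx ?(leq_trans (ltnW kK) Kl)// eqxx /= -ltnNge.
Qed.

Lemma bump_connect x i K v : isbump x i K -> connect (super_edge x (x v)) v (vx i K).
Proof.
move=> bx; have [Kl _ _ _ _] := bx; have [b [k [kb ->]]] := vxP i v.
have sC a : connect_sym (super_edge x a).
  apply: sym_connect_sym => c d.
  by rewrite /super_edge star_adjC; congr (_ && _); rewrite andbC.
have up a k' : (k' <= K)%N -> a <= x (vx i k') ->
    connect (super_edge x a) (vx i k') (vx i K).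
  move=> kK ak; apply: connect_branch => // k1 /andP[h1 h2].
  rewrite /super_edge adj_vx/=; last exact: leq_trans h2 Kl.
  rewrite (le_trans ak) ?(le_trans ak)//; apply: (bump_inc bx).
    by rewrite h2 leqW.
  by rewrite h1 ltnW.
have [bi|bi] := eqVneq b i.
  subst b; have [kK|/ltnW Kk] := leqP k K; first exact: up.
  rewrite sC; apply: connect_branch => // k1 /andP[h1 h2].
  rewrite /super_edge adj_vx/=; last exact: leq_trans h2 kb.
  apply/andP; split; apply: (bump_dec bx); rewrite ?kb ?h2 ?h1 ?(ltnW h2) ?orbT//.
  by rewrite leqW ?orbT.
apply: (@connect_trans _ _ (vx b 0)).
  rewrite sC; apply: connect_branch => // k1 /andP[h1 h2].
  rewrite /super_edge adj_vx/=; last exact: leq_trans h2 kb.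
  by apply/andP; split; apply: (bump_dec bx); rewrite ?kb ?h2 ?(ltnW h2) ?bi.
apply: (up _ 0%N) => //.
exact: bump_centre bx bi kb.
Qed.

Lemma star_connected (e : rel V) (i : 'I_n) u v : connect_sym e ->
  (forall b k, (k < l b)%N -> e (vx b k) (vx b k.+1)) -> connect e u v.
Proof.
move=> sC h.
have c v' : connect e None v'.
  have [b [k [kb ->]]] := vxP i v'.
  apply: (@connect_branch e b 0) => // k1 /andP[_ k1k]; apply: h.
  exact: leq_trans k1k kb.
by apply: connect_trans (c v); rewrite sC.
Qed.

End Star.

Arguments vx : simpl never.

Section Reparam.
Context {R : realType} {V : finType} (adj : rel V) (z z' : V -> R).

(** Sublevel connectivity depends only on the order of the values. This is what allows the part
    above level 4 to be cut off along a straight line. *)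
Lemma two_basins_reparam u w : two_basins adj z u w ->
  (forall v, z v <= 4 -> z' v = z v) -> (forall v, 4 <= z v -> 4 <= z' v) ->
  (forall v v', z v <= z v' -> z' v <= z' v') -> two_basins adj z' u w.
Proof.
move=> [zu zw h uw4 N4] lo hi mono.
have sub v : subrel (connect (sub_edge adj z (z v))) (connect (sub_edge adj z' (z' v))).
  apply: connect_sub => a b /andP[ab]; rewrite ge_max => /andP[av bv]; apply: connect1.
  by rewrite /sub_edge ab ge_max !mono.
split.
- by rewrite lo zu//; lra.
- by rewrite lo zw//; lra.
- by move=> v; case: (h v) => /sub; [left|right].
- move: uw4; apply: connect_sub => a b /andP[ab]; rewrite ge_max => /andP[av bv].
  by apply: connect1; rewrite /sub_edge ab ge_max !lo// av.
- move=> s s4; apply: contra (N4 s s4); apply: connect_sub => a b /andP[ab].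
  rewrite ge_max => /andP[av bv]; apply: connect1; rewrite /sub_edge ab ge_max.
  have lt4 x : z' x <= s -> z x <= s.
    have [x4|/ltW/hi x4] := leP (z x) 4; first by rewrite lo.
    by move=> /(le_trans x4); lra.
  by rewrite !lt4.
Qed.

End Reparam.

(** * Pairs of separated bumps *)

Section Pairs.
Context {R : realType} {n : nat} (l : 'I_n -> nat).
Local Notation V := (starV n l).
Local Notation adj := (@star_adj n l).
Local Notation EX := (prod_topology (fun _ : V => (R : Type))).
Local Notation EC := (prod_topology (fun _ : bool * V => (R : Type))).
Implicit Types (c : bool * V -> R) (s : bool).

Definition side c s : V -> R := fun v => c (s, v).

(* Bump ~~ s is confined to branch j, outside of everything that bump s
   occupies there, with a gap of at least one vertex between them. *)
Definition inner s (j : 'I_n) c :=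
  [/\ exists i K, isbump (side c s) i K, exists i K, isbump (side c (~~ s)) i K,
    forall v, ~~ beyond j 1 v -> c (~~ s, v) = 0 &
    forall k k', (k <= l j)%N -> (k' <= l j)%N -> (k' <= k.+1)%N ->
      c (s, vx l j k) * c (~~ s, vx l j k') = 0].

Definition pair_set : set EC := [set c | exists p : bool * 'I_n, inner p.1 p.2 c].

Lemma inner_sep s j c v v' : inner s j c -> v = v' \/ adj v v' ->
  c (s, v) * c (~~ s, v') = 0.
Proof.
move=> [_ _ out sep] vv'; have [bv'|/out->] := boolP (beyond j 1 v'); last by rewrite mulr0.
case: vv' => [->|/adjP[b [k [kb [[-> vE]|[-> vE]]]]]].
- have [b [k [kb vE]]] := vxP j v'.
  move: bv'; rewrite vE beyond_vx// => /andP[/eqP bj _]; subst b.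
  by apply: sep => //; rewrite leqW.
- move: bv'; rewrite vE beyond_vx// => /andP[/eqP bj _]; subst b.
  by apply: sep => //; rewrite ltnW.
- move: bv'; rewrite vE beyond_vx ?(ltnW kb)// => /andP[/eqP bj _]; subst b.
  by apply: sep; rewrite ?(ltnW kb)//; lia.
Qed.

Lemma pair_sep c v v' : pair_set c -> v = v' \/ adj v v' ->
  c (false, v) * c (true, v') = 0.
Proof.
move=> [[[] j] /= h] vv'; last exact: (inner_sep h vv').
rewrite mulrC; apply: (inner_sep h).
by case: vv' => [->|]; [left|rewrite star_adjC; right].
Qed.

(** Each alternative in the last hypothesis makes [s] the bump nearer to the centre. Were it
    positive at [k] and the other bump at some [k'] further in, unimodality would make both positive
    at [k'] or at the peak of bump [s], against separation. *)
Lemma sep_inner_aux s c i K j L : isbump (side c s) i K -> isbump (side c (~~ s)) j L ->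
  (forall v v', v = v' \/ adj v v' -> c (s, v) * c (~~ s, v') = 0) ->
  [|| 0 < c (s, None), (i != j) && (c (~~ s, None) == 0) |
      [&& c (~~ s, None) == 0, i == j & (K < L)%N]] -> inner s j c.
Proof.
move=> bx by_ sep H.
have [Kl x0 x1 _ _] := bx; have [Ll y0 y1 _ _] := by_.
have sepk k k' b : (k <= l b)%N -> (k' <= l b)%N -> (k <= k'.+1)%N -> (k' <= k.+1)%N ->
    c (s, vx l b k) * c (~~ s, vx l b k') = 0.
  move=> kb k'b h1 h2; apply: sep; case: (ltngtP k k') => kk'; last by left; rewrite kk'.
  - have -> : k' = k.+1 by lia.
    by right; apply: adj_vx; lia.
  - have -> : k = k'.+1 by lia.
    by right; rewrite star_adjC; apply: adj_vx; lia.
have yc : c (~~ s, None) = 0.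
  case/or3P: H => [xc|/andP[_ /eqP//]|/and3P[/eqP//]].
  have := sep None None (or_introl erefl) => /eqP; rewrite mulf_eq0 => /orP[|/eqP//].
  by rewrite gt_eqF.
have out v : ~~ beyond j 1 v -> c (~~ s, v) = 0.
  move=> nb; have [b [k [kb vE]]] := vxP j v; subst v.
  case: k kb nb => [|k] kb; first by rewrite vx0.
  rewrite beyond_vx//= andbT => bj; have := bump_centre by_ bj kb; rewrite /side yc => h.
  by apply/le_anti; rewrite h [0 <= _]y0.
split=> //; [by exists i, K|by exists j, L|].
move=> k k' kj k'j kk'.
have [->|k'0] := posnP k'; first by rewrite vx0 yc mulr0.
have [kk|kk] := leqP k k'.+1; first exact: sepk.
apply/eqP; rewrite mulf_eq0; apply/negPn/negP; rewrite negb_or => /andP[xk yk'].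
have {}xk : 0 < side c s (vx l j k) by rewrite lt_def xk x0.
have {}yk' : 0 < side c (~~ s) (vx l j k') by rewrite lt_def yk' y0.
have clash m : (m <= l j)%N -> 0 < side c s (vx l j m) -> 0 < side c (~~ s) (vx l j m) -> False.
  move=> mj h1 h2; have := sep _ _ (or_introl (erefl (vx l j m))) => /eqP.
  by rewrite mulf_eq0 gt_eqF// gt_eqF.
have mid (x : V -> R) i' K' m1 m2 m3 : isbump x i' K' -> (m1 <= m2 <= m3)%N -> (m3 <= l j)%N ->
    0 < x (vx l j m1) -> 0 < x (vx l j m3) -> 0 < x (vx l j m2).
  move=> b h1 h2 h3 h4; apply: lt_le_trans (bump_mid b h1 h2).
  by rewrite lt_min h3.
case/or3P: H => [xc|/andP[ij _]|/and3P[_ /eqP ij KL]].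
- apply: (clash k') => //; apply: (mid _ _ _ 0%N k' k bx) => //; lia.
- have := bump_centre bx _ kj; rewrite eq_sym ij => /(_ isT) h.
  have xc : 0 < c (s, None) by exact: lt_le_trans xk h.
  by apply: (clash k') => //; apply: (mid _ _ _ 0%N k' k bx) => //; lia.
- subst j; have xK : 0 < side c s (vx l i K) by rewrite x1.
  have yL : 0 < side c (~~ s) (vx l i L) by rewrite y1.
  have [kK|Kk] := leqP k' K.
  + by apply: (clash K) => //; apply: (mid _ _ _ k' K L by_) => //; lia.
  + by apply: (clash k') => //; apply: (mid _ _ _ K k' k bx) => //; lia.
Qed.

(** A bump that is positive at the centre is the inner one. If neither is, different branches allow
    either choice, and on a common branch the nearer peak decides; equal peaks would have product
    1. *)
Lemma sep_pair c i K j L : isbump (side c false) i K -> isbump (side c true) j L ->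
  (forall v v', v = v' \/ adj v v' -> c (false, v) * c (true, v') = 0) -> pair_set c.
Proof.
move=> bx by_ sep.
have sep' v v' : v = v' \/ adj v v' -> c (true, v) * c (false, v') = 0.
  move=> vv'; rewrite mulrC; apply: sep.
  by case: vv' => [->|]; [left|rewrite star_adjC; right].
have [Kl x0 x1 _ _] := bx; have [Ll y0 y1 _ _] := by_.
have [xc|xc] := ltP 0 (c (false, None)).
  by exists (false, j); apply: (sep_inner_aux bx by_) => //; rewrite xc.
have [yc|yc] := ltP 0 (c (true, None)).
  by exists (true, i); apply: (sep_inner_aux by_ bx) => //; rewrite yc.
have {}xc : c (false, None) = 0 by apply/le_anti; rewrite xc [0 <= _]x0.
have {}yc : c (true, None) = 0 by apply/le_anti; rewrite yc [0 <= _]y0.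
have [ij|ij] := eqVneq i j; last first.
  by exists (false, j); apply: (sep_inner_aux bx by_) => //; rewrite ij yc eqxx orbT.
subst j; case: (ltngtP K L) => KL.
- by exists (false, i); apply: (sep_inner_aux bx by_) => //; rewrite yc !eqxx KL !orbT.
- by exists (true, i); apply: (sep_inner_aux by_ bx) => //; rewrite xc !eqxx KL !orbT.
- subst L; have := sep _ _ (or_introl (erefl (vx l i K))).
  by rewrite /side in x1 y1; rewrite x1 y1 mulr1 => /eqP; rewrite oner_eq0.
Qed.

Definition pair_height c : V -> R := fun v => 4 - 4 * c (false, v) - 3 * c (true, v).

(** [bell] supplies the lower bump; the other one solves z = 4 - 4x - 3y for y, with z cut off at
    4. *)
Definition height_pair (z : V -> R) : bool * V -> R := fun p =>
  if p.1 then (4 - Num.min (z p.2) 4 - 4 * bell adj #|{: V}| z p.2) / 3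
  else bell adj #|{: V}| z p.2.

Lemma pair_bumps c : pair_set c -> exists i K j L,
  isbump (side c false) i K /\ isbump (side c true) j L.
Proof.
by move=> [[[] b] /= [[i [K bx]] [j [L by_]] _ _]]; [exists j, L, i, K|exists i, K, j, L].
Qed.

Lemma pair_basins c i K j L : pair_set c -> isbump (side c false) i K ->
  isbump (side c true) j L -> two_basins adj (pair_height c) (vx l i K) (vx l j L).
Proof.
move=> Cc bx by_; have [Kl x0 x1 _ _] := bx; have [Ll y0 y1 _ _] := by_.
rewrite /side in x0 x1 y0 y1.
have sep v v' := pair_sep (v := v) (v' := v') Cc.
have excl v v' : v = v' \/ adj v v' -> 0 < c (false, v) -> c (true, v') = 0.
  by move=> /sep/eqP; rewrite mulf_eq0 => /orP[/eqP->|/eqP//]; rewrite ltxx.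
have excl' v v' : v = v' \/ adj v v' -> 0 < c (true, v') -> c (false, v) = 0.
  by move=> /sep/eqP; rewrite mulf_eq0 => /orP[/eqP//|/eqP->]; rewrite ltxx.
have eqv v : v = v \/ adj v v by left.
have le4 v : pair_height c v <= 4.
  by rewrite /pair_height; have := x0 v; have := y0 v; lra.
have all4 (a : R) u v : 4 <= a -> connect (sub_edge adj (pair_height c) a) u v.
  move=> a4; apply: (star_connected i); first exact: sub_edgeC (@star_adjC _ _) _.
  move=> b k kb; rewrite /sub_edge adj_vx// ge_max.
  by rewrite !(le_trans (le4 _)).
have xu : c (true, vx l i K) = 0 by apply: excl (eqv _) _; rewrite x1.
have yw : c (false, vx l j L) = 0 by apply: excl' (eqv _) _; rewrite y1.
split.
- by rewrite /pair_height x1 xu; lra.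
- by rewrite /pair_height y1 yw; lra.
- move=> v; have [xv|xv] := ltP 0 (c (false, v)).
    left; move: (bump_connect v bx); apply: connect_sub => a b /and3P[ab va vb].
    apply: connect1; rewrite /sub_edge ab ge_max /pair_height.
    rewrite (excl _ _ (eqv v) xv) (excl _ _ (eqv a)); last exact: lt_le_trans xv va.
    rewrite (excl _ _ (eqv b)); last exact: lt_le_trans xv vb.
    by rewrite /side in va vb; apply/andP; split; lra.
  have [yv|yv] := ltP 0 (c (true, v)).
    right; move: (bump_connect v by_); apply: connect_sub => a b /and3P[ab va vb].
    apply: connect1; rewrite /sub_edge ab ge_max /pair_height.
    rewrite (excl' _ _ (eqv v) yv) (excl' _ _ (eqv a)); last exact: lt_le_trans yv va.
    rewrite (excl' _ _ (eqv b)); last exact: lt_le_trans yv vb.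
    by rewrite /side in va vb; apply/andP; split; lra.
  by left; apply: all4; rewrite /pair_height; lra.
- exact: all4.
(* Below level 4 the set where the lower bump is positive is closed under edges: its neighbours
   carry no upper bump, so a height below 4 forces the lower bump to be positive there. The set
   contains the first peak but not the second. *)
- move=> s s4; apply/negP => /(@closed_connect _ _ [pred v | 0 < c (false, v)]) /=.
  rewrite !inE x1 yw ltxx ltr01 => h; suff: true = false by [].
  apply: h => a b /andP[ab]; rewrite ge_max !inE /pair_height => /andP[za zb].
  apply/idP/idP => h.
  + by have := excl a b (or_intror ab) h; lra.
  + have ba : adj b a by rewrite star_adjC.
    by have := excl b a (or_intror ba) h; lra.
Qed.

Lemma basins_pair (i0 : 'I_n) z u w : two_basins adj z u w -> pair_set (height_pair z).
Proof.
move=> zuw; have aC := @star_adjC n l.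
have [i [K [Kl uE]]] := vxP i0 u; have [j [L [Ll wE]]] := vxP i0 w.
have [zu zw h _ N4] := zuw.
have xE v : height_pair z (false, v) = if basin adj z u v then 1 - z v / 4 else 0.
  exact: (bell_eq aC zuw).
have disj v : basin adj z u v -> basin' adj z w v -> False.
  by move=> h1 h2; apply: (basin_disj aC zuw h1 h2); left.
have yE v : height_pair z (true, v) = if basin' adj z w v then (4 - z v) / 3 else 0.
  rewrite /height_pair /= (bell_eq aC zuw); case: (basin_cases zuw v) => b.
  - rewrite b; case: ifP => [/(disj _ b)//|_]; case/andP: b => v4 _.
    by rewrite min_l ?ltW//; lra.
  - rewrite b; case: ifP => [/disj/(_ b)//|_]; case/andP: b => v4 _.
    by rewrite min_l ?ltW//; lra.
  - rewrite min_r// /basin /basin' !le_gtF//=; lra.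
have into (s : R) v : s < 4 -> z v <= s -> connect (sub_edge adj z s) v u -> basin adj z u v.
  move=> s4 vs c; case: (basin_cases zuw v) => // [/andP[_ c']|]; last lra.
  exfalso; apply: (negP (N4 s s4)); apply: (connect_trans (y := v)).
    by rewrite sub_edgeC.
  exact: (sub_edgeS vs).
have into' (s : R) v : s < 4 -> z v <= s -> connect (sub_edge adj z s) v w -> basin' adj z w v.
  move=> s4 vs c; case: (basin_cases zuw v) => // [/andP[_ c']|]; last lra.
  exfalso; apply: (negP (N4 s s4)); apply: (connect_trans (y := v)) c.
  by rewrite sub_edgeC//; exact: (sub_edgeS vs).
have bx : isbump (side (height_pair z) false) i K.
  apply: connect_bump => //.
  - by move=> v; rewrite /side xE; case: ifP => // /andP[v4 _]; lra.
  - by rewrite -uE /side xE /basin zu connect0 andbT ltr0n /=; lra.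
  - rewrite -uE => v; rewrite /side xE; case: ifP => [/andP[v4 vu]|]; last by rewrite ltxx.
    (* The start of the path is generalised while the level [z v] stays fixed, so that the induction
       remains in one superlevel set. *)
    move=> _; case/connectP: vu => p; move: (lexx (z v)); move: {1 4 5 7}v.
    elim: p => [|b p IH] a /= av; first by move=> _ ->; exact: connect0.
    move=> /andP[ab pb] lp; have bv : z b <= z v by case/andP: ab; rewrite ge_max => _ /andP[].
    apply: connect_trans (connect1 _) (IH b bv pb lp).
    have cb : connect (sub_edge adj z (z v)) b u by apply/connectP; exists p.
    have ca := connect_trans (connect1 ab) cb.
    case/andP: ab => ab _; rewrite /super_edge ab !xE (into _ _ v4 av ca) (into _ _ v4 bv cb) /=.
    by apply/andP; split; lra.
have by_ : isbump (side (height_pair z) true) j L.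
  apply: connect_bump => //.
  - by move=> v; rewrite /side yE; case: ifP => // /andP[v4 _]; lra.
  - by rewrite -wE /side yE /basin' zw connect0 andbT ltr1n /=; lra.
  - rewrite -wE => v; rewrite /side yE; case: ifP => [/andP[v4 vu]|]; last by rewrite ltxx.
    move=> _; case/connectP: vu => p; move: (lexx (z v)); move: {1 4 5 7}v.
    elim: p => [|b p IH] a /= av; first by move=> _ ->; exact: connect0.
    move=> /andP[ab pb] lp; have bv : z b <= z v by case/andP: ab; rewrite ge_max => _ /andP[].
    apply: connect_trans (connect1 _) (IH b bv pb lp).
    have cb : connect (sub_edge adj z (z v)) b w by apply/connectP; exists p.
    have ca := connect_trans (connect1 ab) cb.
    case/andP: ab => ab _; rewrite /super_edge ab !yE (into' _ _ v4 av ca) (into' _ _ v4 bv cb) /=.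
    by apply/andP; split; lra.
apply: (sep_pair bx by_) => v v' vv'; rewrite xE yE.
case: ifP => [b|_]; last by rewrite mul0r.
case: ifP => [b'|_]; last by rewrite mulr0.
by case: (basin_disj aC zuw b b' vv').
Qed.

(** The basin of the first peak is exactly the set where the lower bump is positive, so [bell] reads
    that bump off. *)
Lemma height_pairK c : pair_set c -> height_pair (pair_height c) = c.
Proof.
move=> Cc; have [i [K [j [L [bx by_]]]]] := pair_bumps Cc.
have zuw := pair_basins Cc bx by_; have aC := @star_adjC n l.
have [_ x0 _ _ _] := bx; have [_ y0 _ _ _] := by_; rewrite /side in x0 y0.
have sep v : c (false, v) * c (true, v) = 0 by apply: (pair_sep Cc); left.
have [_ _ h _ N4] := zuw.
have bellE v : bell adj #|{: V}| (pair_height c) v = c (false, v).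
  rewrite (bell_eq aC zuw); have [xv|xv] := ltP 0 (c (false, v)).
    have yv : c (true, v) = 0.
      by move/eqP: (sep v); rewrite mulf_eq0 gt_eqF//= => /eqP.
    have zv : pair_height c v = 4 - 4 * c (false, v) by rewrite /pair_height yv; lra.
    case: (basin_cases zuw v) => [b|b|]; last lra.
      by rewrite b zv; lra.
    have cv : connect (sub_edge adj (pair_height c) (pair_height c v)) v (vx l i K).
      move: (bump_connect v bx); apply: connect_sub => a b' /and3P[ab va vb].
      rewrite /side in va vb.
      have ya (d : V) : c (false, v) <= c (false, d) -> pair_height c d <= pair_height c v.
        by move=> vd; rewrite zv /pair_height; have := y0 d; lra.
      by apply: connect1; rewrite /sub_edge ab ge_max !ya.
    rewrite /basin cv andbT; case: ifP => [_|/negP]; first by rewrite zv; lra.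
    by rewrite zv; lra.
  have {}xv : c (false, v) = 0 by apply/le_anti; rewrite xv x0.
  case: ifP => // b; rewrite xv; case/andP: (b) => v4 _.
  have yv : 0 < c (true, v) by move: v4; rewrite /pair_height xv; lra.
  exfalso; have b' : basin' adj (pair_height c) (vx l j L) v.
    rewrite /basin' v4 /=; move: (bump_connect v by_); apply: connect_sub => a b' /and3P[ab va vb].
    rewrite /side in va vb.
    have ya (d : V) : c (true, v) <= c (true, d) -> pair_height c d <= pair_height c v.
      by move=> vd; rewrite /pair_height xv; have := x0 d; lra.
    by apply: connect1; rewrite /sub_edge ab ge_max !ya.
  by apply: (basin_disj aC zuw b b'); left.
apply/funext => -[[] v]; rewrite /height_pair /= bellE//.
by rewrite min_l /pair_height; have := x0 v; have := y0 v; lra.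
Qed.

Lemma pair_heightK z v : pair_height (height_pair z) v = Num.min (z v) 4.
Proof. by rewrite /pair_height /height_pair /=; lra. Qed.

(** The pair forgets only the heights above 4: one composite is the identity, the other is the
    cut-off at 4, joined to the identity by a straight line. *)
Lemma data_pairs (i0 : 'I_n) :
  homotopy_equivalent R (set_type (@dataP R _ adj)) (set_type pair_set).
Proof.
have aC := @star_adjC n l.
have fP (z : set_type (@dataP R _ adj)) : pair_set (height_pair (set_val z) : EC).
  by have /(PH0_two_basins aC)[u [w /(basins_pair i0)]] := set_type_mem z.
have gP (c : set_type pair_set) : @dataP R _ adj (pair_height (set_val c) : EX).
  have Cc := set_type_mem c; have [i [K [j [L [bx by_]]]]] := pair_bumps Cc.
  exact: two_basins_PH0 aC _ _ (pair_basins Cc bx by_).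
exists (to_sub fP), (to_sub gP); split.
- apply: cts_sub; apply: cts_prod => -[b v].
  have cb : continuous (fun z : EX => bell adj #|{: V}| z v) by exact: bell_cts.
  have cz : continuous (fun z : EX => z v).
    by apply: (@cts_coord R EX V (fun g => g) v) => g.
  suff cF : continuous (fun z : EX => height_pair z (b, v)).
    exact: (cts_comp cF (@cts_val _ _)).
  rewrite /height_pair /=; case: b => //.
  apply: ctsM; last exact: cts_cst.
  apply: ctsD; last by apply: ctsN; apply: ctsM => //; exact: cts_cst.
  apply: ctsD; first exact: cts_cst.
  by apply: ctsN; apply: cts_min => //; exact: cts_cst.
- apply: cts_sub; apply: cts_prod => v.
  have cc b : continuous (fun c : EC => c (b, v)).
    by apply: (@cts_coord R EC _ (fun g => g) (b, v)) => g.
  suff cF : continuous (fun c : EC => pair_height c v).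
    exact: (cts_comp cF (@cts_val _ _)).
  rewrite /pair_height; apply: ctsD; [apply: ctsD|]; first exact: cts_cst.
    by apply: ctsN; apply: ctsM => //; exact: cts_cst.
  by apply: ctsN; apply: ctsM => //; exact: cts_cst.
- pose W := (set_type (@dataP R _ adj) * unit_interval R)%type.
  pose H (p : W) : EX := fun v =>
    (1 - set_val p.2) * Num.min (set_val p.1 v) 4 + set_val p.2 * set_val p.1 v.
  have HP p : @dataP R _ adj (H p).
    have /(PH0_two_basins aC)[u [w zuw]] := set_type_mem p.1.
    have /andP[t0 t1] := unit_intervalP p.2.
    apply: (two_basins_PH0 aC (u := u) (w := w)); apply: (two_basins_reparam zuw).
    + by move=> v v4; rewrite /H min_l//; lra.
    + by move=> v v4; rewrite /H min_r//; nra.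
    + move=> v v' vv'; rewrite /H; apply: lerD; apply: ler_wpM2l => //; first lra.
      by rewrite le_min !ge_min vv' lexx orbT.
  exists (to_sub HP); split; last first.
    split=> z t tE; apply: set_val_inj; rewrite to_subE; apply/funext => v; rewrite /H /= tE.
    + by rewrite !to_subE pair_heightK; lra.
    + by lra.
  apply: cts_sub; apply: cts_prod => v.
  have ct : continuous (fun p : W => set_val p.2 : R).
    by apply: (cts_comp (@cts_val _ _)); exact: cts_snd.
  have cz : continuous (fun p : W => set_val p.1 v : R).
    apply: (@cts_coord R W V (fun p => set_val p.1) v).
    by apply: (cts_comp (@cts_val _ _)); exact: cts_fst.
  apply: ctsD; apply: ctsM => //.
    by apply: ctsD; [exact: cts_cst|exact: ctsN].
  by apply: cts_min => //; exact: cts_cst.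
- rewrite (_ : _ \o _ = idfun); first by apply: homotopic_refl => x.
  apply/funext => c; apply: set_val_inj; rewrite /= !to_subE.
  by apply: height_pairK; exact: set_type_mem.
Qed.

End Pairs.

(** * Retracting pairs of bumps onto the crown graph *)

Section Stages.
Context {R : realType} {n : nat} (l : 'I_n -> nat).
Local Notation V := (starV n l).
Local Notation EX := (prod_topology (fun _ : V => (R : Type))).
Implicit Types (x : V -> R) (J : pred 'I_n).
Hypothesis l2 : forall i, (2 <= l i)%N.

Definition rmax x b (a d : nat) : R :=
  \big[Num.max/0]_(k < (l b).+1 | (a <= k <= d)%N) x (vx l b k).

Lemma rmax_ge x b a d k : (a <= k <= d)%N -> (k <= l b)%N -> x (vx l b k) <= rmax x b a d.
Proof.
move=> akd; rewrite -ltnS => kl.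
pose P (k : 'I_(l b).+1) := (a <= k <= d)%N.
have Pk : P (Ordinal kl) by [].
exact: (le_bigmax_cond 0 (fun k : 'I_(l b).+1 => x (vx l b k)) Pk).
Qed.

Lemma rmax_le x b a d (M : R) : 0 <= M ->
  (forall k, (a <= k <= d)%N -> (k <= l b)%N -> x (vx l b k) <= M) -> rmax x b a d <= M.
Proof. by move=> M0 h; apply: bigmax_le => // k akd; apply: h => //; rewrite -ltnS. Qed.

Lemma rmax_ge0 x b a d : 0 <= rmax x b a d.
Proof. by rewrite /rmax; elim/big_rec: _ => // k y _ y0; rewrite le_max y0 orbT. Qed.

Lemma rmax_sub x b a d a' d' : (a' <= a)%N -> (d <= d')%N ->
  rmax x b a d <= rmax x b a' d'.
Proof.
move=> aa dd; apply: rmax_le => [|k akd kl]; first exact: rmax_ge0.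
by apply: rmax_ge => //; lia.
Qed.

Lemma rmax_eq0 x b a d :
  (forall k, (a <= k <= d)%N -> (k <= l b)%N -> x (vx l b k) = 0) -> rmax x b a d = 0.
Proof.
by move=> h; apply/le_anti; rewrite rmax_ge0 rmax_le// => k h1 h2; rewrite h.
Qed.

Lemma cts_rmax (T : topologicalType) (f : T -> V -> R) b a d :
  (forall v, continuous (fun t => f t v)) -> continuous (fun t => rmax (f t) b a d).
Proof. by move=> cf; apply: cts_bigmax => k _; exact: cf. Qed.

Definition build (c0 : R) (h : 'I_n -> nat -> R) (v : V) : R :=
  if v is Some t then h (tag t) (tagged t).+1 else c0.

Lemma build0 c0 h b : build c0 h (vx l b 0) = c0.
Proof. by []. Qed.

Lemma buildS c0 h b k : (k < l b)%N -> build c0 h (vx l b k.+1) = h b k.+1.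
Proof. by move=> kl; rewrite (vxS kl). Qed.

(** Monotone envelopes replace a chosen peak: on branch [j], [stage1] accumulates the maximum from
    the tip inwards; off [J], [stage2] accumulates it outwards and [stage3] keeps only the branch
    maximum. Its jump after distance 1 leaves the first vertex empty when [m = 0], as a gap. *)
Definition stage1 x m j := build m (fun b k =>
  if b == j then rmax x j k (l j) else Num.max (x (vx l b k)) m).
Definition stage2 x m J := build m (fun b k =>
  if J b then 0 else Num.max m (rmax x b 1 k)).
Definition stage3 x m J := build m (fun b k =>
  if J b then 0 else if (k <= 1)%N then m else Num.max m (rmax x b 1 (l b))).

Lemma isbump_convex x x' i K (s : R) : 0 <= s <= 1 -> isbump x i K -> isbump x' i K ->
  isbump (fun v => (1 - s) * x v + s * x' v) i K.
Proof.
move=> /andP[s0 s1] [h1 h2 h3 h4 h5] [k1 k2 k3 k4 k5]; have s1' : 0 <= 1 - s by lra.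
split=> //.
- by move=> v; rewrite addr_ge0// mulr_ge0.
- by rewrite h3 k3; lra.
- by move=> b k kl bK; rewrite lerD// ler_wpM2l// ?h4// k4.
- by move=> k kK; rewrite lerD// ler_wpM2l// ?h5// k5.
Qed.

Lemma stage1_bump x i K j (m := rmax x j 0 (l j)) : isbump x i K ->
  isbump (stage1 x m j) i K.
Proof.
move=> bx; have [Kl x0 x1 xdec xinc] := bx.
have m0 : 0 <= m by exact: rmax_ge0.
have m1 : m <= 1 by apply: rmax_le => // k _ _; exact: bump_le1 bx.
have xm : x None <= m by apply: (@rmax_ge x j 0 (l j) 0).
rewrite /stage1; split=> //.
- case=> [[b o]|] //=; case: ifP => _; first exact: rmax_ge0.
  by rewrite le_max m0 orbT.
- case: K Kl x1 bx {xdec xinc} => [|K] Kl x1 bx.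
    by rewrite build0; apply/le_anti; rewrite m1 -x1.
  rewrite buildS//; case: eqP => [ij|_]; last by rewrite x1 max_l.
  subst j; apply/le_anti/andP; split.
    by apply: rmax_le => // k _ _; exact: bump_le1 bx.
  by rewrite -x1; apply: rmax_ge; rewrite ?leqnn.
- move=> b k kl bK; rewrite buildS//; case: k kl bK => [|k] kl bK.
    rewrite build0; case: eqP => _; first exact: rmax_sub.
    by rewrite ge_max lexx andbT; apply: le_trans xm; exact: xdec.
  rewrite buildS ?(ltnW kl)//; case: eqP => [_|_]; first exact: rmax_sub.
  by rewrite ge_max !le_max lexx orbT andbT xdec.
- move=> k kK; have kl : (k < l i)%N by exact: leq_trans kK Kl.
  rewrite buildS//; case: eqP => [ij|_].
    subst j; apply: (@le_trans _ _ 1).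
      case: k kK kl => [|k] kK kl; first by rewrite build0.
      rewrite buildS ?(ltnW kl)// eqxx.
      by apply: rmax_le => // k' _ _; exact: bump_le1 bx.
    by rewrite -x1; apply: rmax_ge; rewrite ?kK.
  case: k kK kl => [|k] kK kl; first by rewrite build0 le_max lexx orbT.
  rewrite buildS ?(ltnW kl)//; case: eqP => [ij|_]; last first.
    by rewrite ge_max !le_max lexx orbT andbT xinc.
  subst j; apply: (@le_trans _ _ m); last by rewrite le_max lexx orbT.
  exact: rmax_sub.
Qed.

Section Out.
Variables (x : V -> R) (i : 'I_n) (K : nat) (J : pred 'I_n) (m : R).
Hypotheses (bx : isbump x i K) (K0 : (0 < K)%N) (Ji : ~~ J i) (m01 : 0 <= m <= 1).
Hypothesis xm : forall b k, b != i -> ~~ J b -> (k <= l b)%N -> x (vx l b k) <= m.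

Let x1 := let: And5 _ _ x1 _ _ := bx in x1.
Let Kl := let: And5 Kl _ _ _ _ := bx in Kl.
Let m0 : 0 <= m. Proof. by case/andP: m01. Qed.

Lemma rmax_root d : (K <= d)%N -> rmax x i 1 d = 1.
Proof.
move=> Kd; apply/le_anti/andP; split.
  by apply: rmax_le => // k _ _; exact: bump_le1 bx.
by rewrite -x1; apply: rmax_ge; rewrite ?K0 ?Kd.
Qed.

Lemma rmax_other b a d : b != i -> ~~ J b -> rmax x b a d <= m.
Proof. by move=> bi Jb; apply: rmax_le => // k _ kl; exact: xm. Qed.

Lemma max_rmax_other b a d : b != i -> ~~ J b -> Num.max m (rmax x b a d) = m.
Proof. by move=> bi Jb; rewrite max_l// rmax_other. Qed.

Lemma max_rmax_root d : (K <= d)%N -> Num.max m (rmax x i 1 d) = 1.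
Proof. by move=> Kd; rewrite rmax_root// max_r//; case/andP: m01. Qed.

(** The top is flat from [K] to the tip, so the peak can be renamed from [K], shared with the
    previous stage, to [l i], shared with [stage3]. The lemma serves the inner bump with
    [J = pred1 j] and the confined one with [J = pred0], [m = 0]. *)
Lemma stage2_bump K' : (K <= K' <= l i)%N -> isbump (stage2 x m J) i K'.
Proof.
move=> /andP[KK' K'l]; rewrite /stage2; split=> //.
- by case=> [[b o]|] //=; case: ifP => // _; rewrite le_max m0.
- have -> : K' = K'.-1.+1 by lia.
  by rewrite buildS ?(negPf Ji) ?max_rmax_root//; lia.
- move=> b k kl bK; rewrite buildS//; case: ifP => [_|/negbT Jb].
    by case: k {bK} kl => [|k] kl; rewrite ?build0// buildS ?(ltnW kl)//; case: ifP => // _; rewrite le_max m0.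
  have [bi|bi] := eqVneq b i.
    subst b; rewrite eqxx /= in bK.
    case: k kl bK => [|k] kl bK; first by lia.
    by rewrite buildS ?(ltnW kl)// (negPf Jb) !max_rmax_root//; lia.
  rewrite max_rmax_other//; case: k kl bK => [|k] kl bK; first by rewrite build0.
  by rewrite buildS ?(ltnW kl)// (negPf Jb) max_rmax_other.
- move=> k kK; have kl : (k < l i)%N by lia.
  rewrite buildS// (negPf Ji); case: k kK kl => [|k] kK kl.
    by rewrite build0 le_max lexx.
  by rewrite buildS ?(ltnW kl)// (negPf Ji) ge_max !le_max lexx /= rmax_sub ?orbT.
Qed.

Lemma stage3_bump : isbump (stage3 x m J) i (l i).
Proof.
rewrite /stage3; split=> //.
- by case=> [[b o]|] //=; case: ifP => // _; case: ifP => // _; rewrite le_max m0.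
- have li := l2 i; have lE : (l i).-2.+2 = l i by lia.
  rewrite -{1}lE buildS; last lia.
  by rewrite (negPf Ji) /= max_rmax_root.
- move=> b k kl bK; have bi : b != i by case/orP: bK => // h; apply/eqP => bi; rewrite bi in kl; lia.
  rewrite buildS//; case: ifP => [_|/negbT Jb].
    by case: k {bK} kl => [|k] kl; rewrite ?build0// buildS ?(ltnW kl)//; case: ifP => // _; case: ifP => // _; rewrite le_max m0.
  rewrite max_rmax_other// if_same; case: k kl bK => [|k] kl bK; first by rewrite build0.
  by rewrite buildS ?(ltnW kl)// (negPf Jb) max_rmax_other// if_same.
- move=> k kl; rewrite buildS// (negPf Ji); case: k kl => [|k] kl.
    by rewrite build0.
  rewrite buildS ?(ltnW kl)// (negPf Ji) /=; case: ifP => _; last by [].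
  by rewrite le_max lexx.
Qed.

End Out.

(** All three stages take the value 1 at the centre, so the peak may be placed there. This handles a
    peak inside branch [j], which [stage2] is going to clear. *)
Lemma flat_bumps x i K j : isbump x i K -> rmax x j 0 (l j) = 1 ->
  [/\ isbump (stage1 x 1 j) j 0, isbump (stage2 x 1 (pred1 j)) j 0 &
      isbump (stage3 x 1 (pred1 j)) j 0].
Proof.
move=> bx mE; have x1 v : x v <= 1 by exact: bump_le1 bx.
have r1 b a d : rmax x b a d <= 1 by exact: rmax_le.
have M1 b a d : Num.max 1 (rmax x b a d) = 1 by rewrite max_l.
have dec0 (c : V -> R) : (forall v, 0 <= c v) -> c None = 1 ->
    (forall b k, (k < l b)%N -> c (vx l b k.+1) <= c (vx l b k)) -> isbump c j 0.
  by move=> c0 c1 h; split=> // b k kl _; exact: h.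
rewrite /stage1 /stage2 /stage3; split; apply: dec0 => //.
- case=> [[b o]|] //=; case: ifP => _; first exact: rmax_ge0.
  by rewrite le_max ler01 orbT.
- move=> b k kl; rewrite buildS//; case: k kl => [|k] kl.
    by rewrite build0; case: ifP => // _; rewrite max_r.
  rewrite buildS ?(ltnW kl)//; case: ifP => _; first exact: rmax_sub.
  by rewrite !max_r.
- by case=> [[b o]|] //=; case: ifP => // _; rewrite M1.
- move=> b k kl; rewrite buildS//; case: k kl => [|k] kl.
    by rewrite build0; case: ifP => // _; rewrite M1.
  by rewrite buildS ?(ltnW kl)//; case: ifP => // _; rewrite !M1.
- by case=> [[b o]|] //=; case: ifP => // _; rewrite M1 if_same.
- move=> b k kl; rewrite buildS//; case: k kl => [|k] kl.
    by rewrite build0; case: ifP => // _; rewrite M1 if_same.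
  by rewrite buildS ?(ltnW kl)//; case: ifP => // _; rewrite !M1 !if_same.
Qed.

End Stages.

(** * The homotopy on separated pairs and the maps to and from the crown *)

Section Retract.
Context {R : realType} {n : nat} (l : 'I_n -> nat).
Local Notation V := (starV n l).
Local Notation adj := (@star_adj n l).
Local Notation EC := (prod_topology (fun _ : bool * V => (R : Type))).
Local Notation EG := (prod_topology (fun _ : bool * 'I_n => (R : Type))).
Implicit Types (c : bool * V -> R) (s : bool).
Hypothesis l2 : forall i, (2 <= l i)%N.
Hypothesis n2 : (2 <= n)%N.

Definition reach s j c : R := rmax (side c s) j 0 (l j).

Lemma inner_outer s j c : inner s j c -> exists2 L, isbump (side c (~~ s)) j L & (0 < L)%N.
Proof.
move=> [_ [j' [L by_]] out _]; have [Ll _ y1 _ _] := by_.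
have [|/out yz] := boolP (beyond j 1 (vx l j' L)).
  by rewrite beyond_vx// => /andP[/eqP jj L0]; subst j'; exists L.
by move/eqP: y1; rewrite /side yz eq_sym oner_eq0.
Qed.

Lemma inner_off s j c b k : inner s j c -> b != j -> (k <= l b)%N -> side c (~~ s) (vx l b k) = 0.
Proof.
move=> [_ _ out _] bj kb; apply: out; case: k kb => [|k] kb; first by rewrite vx0.
by rewrite beyond_vx// (negPf bj).
Qed.


Lemma reach01 s j c : inner s j c -> 0 <= reach s j c <= 1.
Proof.
move=> [[i [K bx]] _ _ _]; rewrite rmax_ge0 /=; apply: rmax_le => // k _ _.
exact: bump_le1 bx.
Qed.

Lemma reach_centre s j c : side c s None <= reach s j c.
Proof. exact: (@rmax_ge R n l (side c s) j 0 (l j) 0). Qed.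

(** A peak on branch [j] or at the centre makes [reach] equal to 1. Otherwise the values off the
    branch of the peak are bounded by the value at the centre, hence by [reach]. *)
Lemma inner_cases s j c : inner s j c ->
  reach s j c = 1 \/ exists i K, [/\ isbump (side c s) i K, (0 < K)%N, i != j &
    forall b k, b != i -> (k <= l b)%N -> side c s (vx l b k) <= reach s j c].
Proof.
move=> inn; have /andP[m0 m1] := reach01 inn; have [[i [K bx]] _ _ _] := inn.
have [Kl x0 x1 _ _] := bx.
have [ij|ij] := eqVneq i j.
  left; subst j; apply/le_anti; rewrite m1 -x1; apply: rmax_ge => //.
have [K0|K0] := posnP K.
  left; apply/le_anti; rewrite m1 -x1 K0; exact: reach_centre.
right; exists i, K; split=> // b k bi kb; apply: le_trans (reach_centre s j c).
exact: bump_centre bx bi kb.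
Qed.

Definition hop s j c (t : R) : EC := fun p =>
  let x := side c s in let y := side c (~~ s) in let m := reach s j c in
  if p.1 == s then chain3 (x p.2) (stage1 x m j p.2) (stage2 x m (pred1 j) p.2)
                          (stage3 x m (pred1 j) p.2) t
  else chain3 (y p.2) (y p.2) (stage2 y 0 pred0 p.2) (stage3 y 0 pred0 p.2) t.

Lemma side_hop s j c t : let x := side c s in let m := reach s j c in
  side (hop s j c t) s = fun v => chain3 (x v) (stage1 x m j v)
    (stage2 x m (pred1 j) v) (stage3 x m (pred1 j) v) t.
Proof. by apply/funext => v; rewrite /side /hop /= eqxx. Qed.

Lemma side_hopN s j c t : let y := side c (~~ s) in
  side (hop s j c t) (~~ s) = fun v => chain3 (y v) (y v)
    (stage2 y 0 pred0 v) (stage3 y 0 pred0 v) t.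
Proof. by apply/funext => v; rewrite /side /hop /=; case: s. Qed.

Lemma chain3_bump (x0 x1 x2 x3 : V -> R) (t : R) :
  (exists i K, isbump x0 i K /\ isbump x1 i K) ->
  (exists i K, isbump x1 i K /\ isbump x2 i K) ->
  (exists i K, isbump x2 i K /\ isbump x3 i K) ->
  exists i K, isbump (fun v => chain3 (x0 v) (x1 v) (x2 v) (x3 v) t) i K.
Proof.
move=> [i0 [K0 [a0 b0]]] [i1 [K1 [a1 b1]]] [i2 [K2 [a2 b2]]].
have [s [s01 [sE|sE|sE]]] := chain3P t.
- exists i0, K0; rewrite (_ : (fun v => _) = fun v => (1 - s) * x0 v + s * x1 v).
    exact: isbump_convex.
  by apply/funext => v; rewrite sE.
- exists i1, K1; rewrite (_ : (fun v => _) = fun v => (1 - s) * x1 v + s * x2 v).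
    exact: isbump_convex.
  by apply/funext => v; rewrite sE.
- exists i2, K2; rewrite (_ : (fun v => _) = fun v => (1 - s) * x2 v + s * x3 v).
    exact: isbump_convex.
  by apply/funext => v; rewrite sE.
Qed.

(** On each segment both factors are affine in the same parameter, so the product expands into four
    corner products; the hypotheses list the corners of the three segments. *)
Lemma chain3_mul0 (a0 a1 a2 a3 b0 b2 b3 t : R) :
  a0 * b0 = 0 -> a1 * b0 = 0 -> a1 * b2 = 0 -> a2 * b0 = 0 -> a2 * b2 = 0 ->
  a2 * b3 = 0 -> a3 * b2 = 0 -> a3 * b3 = 0 ->
  chain3 a0 a1 a2 a3 t * chain3 b0 b0 b2 b3 t = 0.
Proof.
move=> h1 h2 h3 h4 h5 h6 h7 h8.
have mulE (s a a' b b' : R) : a * b = 0 -> a * b' = 0 -> a' * b = 0 -> a' * b' = 0 ->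
    ((1 - s) * a + s * a') * ((1 - s) * b + s * b') = 0.
  move=> e1 e2 e3 e4; transitivity ((1 - s) ^+ 2 * (a * b) + (1 - s) * s * (a * b')
    + (1 - s) * s * (a' * b) + s ^+ 2 * (a' * b')); first by ring.
  by rewrite e1 e2 e3 e4 !mulr0 !addr0.
by have [s [_ [sE|sE|sE]]] := chain3P t; rewrite !sE; apply: mulE.
Qed.

Lemma inner_hop s j c t : inner s j c -> inner s j (hop s j c t).
Proof.
move=> inn; have [_ _ out sep] := inn.
set x := side c s; set y := side c (~~ s); set m := reach s j c.
have [L by_ L0] := inner_outer inn; have [Ll y0 _ _ _] := by_.
have m01 := reach01 inn; have /andP[m0 m1] := m01.
have yoff b k : b != j -> ~~ pred0 b -> (k <= l b)%N -> y (vx l b k) <= 0.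
  by move=> bj _ kb; rewrite /y (inner_off inn).
have z01 : 0 <= (0 : R) <= 1 by rewrite lexx ler01.
have roff b d : b != j -> rmax y b 1 d = 0.
  by move=> bj; apply: rmax_eq0 => k _ kl; rewrite /y (inner_off inn).
split.
- rewrite side_hop; have [[i [K bx]] _ _ _] := inn; case: (inner_cases inn) => [mE|].
    have [f1 f2 f3] := flat_bumps bx mE; rewrite -/x in bx f1 f2 f3 *.
    apply: chain3_bump; last by rewrite mE; exists j, 0%N.
      by exists i, K; split=> //; exact: stage1_bump.
    by rewrite mE; exists j, 0%N.
  move=> {bx}[{}i [{}K [bx K0 ij dom]]].
  have ji : ~~ pred1 j i by rewrite /= ij.
  have dom' b k : b != i -> ~~ pred1 j b -> (k <= l b)%N -> side c s (vx l b k) <= reach s j c.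
    by move=> bi _; exact: dom.
  have [Kl _ _ _ _] := bx.
  apply: chain3_bump.
  + by exists i, K; split=> //; exact: stage1_bump.
  + exists i, K; split; first exact: stage1_bump.
    by apply: (stage2_bump bx K0 ji m01 dom'); rewrite leqnn.
  + exists i, (l i); split; last exact: (stage3_bump l2 bx K0 ji m01 dom').
    by apply: (stage2_bump bx K0 ji m01 dom'); rewrite leqnn Kl.
- rewrite side_hopN -/y.
  apply: chain3_bump.
  + by exists j, L.
  + exists j, L; split=> //.
    by apply: (stage2_bump by_ L0 _ z01 yoff) => //; rewrite leqnn.
  + exists j, (l j); split; last exact: (stage3_bump l2 by_ L0 _ z01 yoff).
    by apply: (stage2_bump by_ L0 _ z01 yoff) => //; rewrite leqnn Ll.
- move=> v nb; rewrite -[LHS]/(side (hop s j c t) (~~ s) v) side_hopN -/y.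
  have [b [k [kb vE]]] := vxP j v; subst v; have y0' := out _ nb.
  rewrite [y _]y0'; case: k kb nb y0' => [|k] kb nb y0'.
    by rewrite /stage2 /stage3 !build0 /chain3 !subrr !mulr0 !addr0.
  have bj : b != j by move: nb; rewrite beyond_vx//= andbT.
  by rewrite /stage2 /stage3 !buildS//= !roff// maxxx if_same /chain3 !subrr !mulr0 !addr0.
- move=> k k' kj k'j kk'.
  rewrite -[X in X * _]/(side (hop s j c t) s _) -[X in _ * X]/(side (hop s j c t) (~~ s) _).
  rewrite side_hop side_hopN -/x -/y -/m.
  have xy k1 k2 : (k1 <= l j)%N -> (k2 <= l j)%N -> (k2 <= k1.+1)%N ->
    y (vx l j k2) != 0 -> x (vx l j k1) = 0.
    move=> h1 h2 h3 /negPf h4; have /eqP := sep _ _ h1 h2 h3.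
    by rewrite mulf_eq0 [_ == 0 in X in _ || X]h4 orbF => /eqP.
  (* The gap condition for [k2 <= k1.+1] also holds for every distance beyond [k1], so the whole
     maximum that defines [stage1] vanishes. *)
  have s1 k1 k2 : (k1 <= l j)%N -> (k2 <= l j)%N -> (k2 <= k1.+1)%N ->
      y (vx l j k2) != 0 -> stage1 x m j (vx l j k1) = 0.
    move=> h1 h2 h3 h4; have r0 : rmax x j k1 (l j) = 0.
      by apply: rmax_eq0 => k3 /andP[h5 h6] h7; apply: (xy k3 k2) => //; lia.
    by case: k1 h1 h3 r0 => [|k1] h1 h3 r0; rewrite /stage1 ?build0// buildS// eqxx.
  have s1y k2 : (k2 <= l j)%N -> (k2 <= k.+1)%N -> stage1 x m j (vx l j k) * y (vx l j k2) = 0.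
    move=> h1 h2; have [->|h3] := eqVneq (y (vx l j k2)) 0; first by rewrite mulr0.
    by rewrite (s1 k k2)// mul0r.
  have s1r k2 : (k2 <= l j)%N -> (k2 <= k.+1)%N ->
      stage1 x m j (vx l j k) * stage2 y 0 pred0 (vx l j k2) = 0.
    move=> h1 h2; rewrite /stage2; case: k2 h1 h2 => [|k2] h1 h2; first by rewrite build0 mulr0.
    rewrite buildS//= max_r ?rmax_ge0//.
    have [->|h3] := eqVneq (stage1 x m j (vx l j k)) 0; first by rewrite mul0r.
    rewrite rmax_eq0 ?mulr0// => k3 /andP[h5 h6] h7; apply/eqP; apply: contraNT h3 => h3.
    by rewrite (s1 k k3)//; lia.
  have s23 : (0 < k)%N -> stage2 x m (pred1 j) (vx l j k) = 0 /\ stage3 x m (pred1 j) (vx l j k) = 0.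
    by case: (k) kj => // k1 k1j _; rewrite /stage2 /stage3 !buildS//= eqxx.
  have e20 : k = 0%N -> stage2 x m (pred1 j) (vx l j k) = stage1 x m j (vx l j k).
    by move=> ->.
  have e30 : k = 0%N -> stage3 x m (pred1 j) (vx l j k) = stage1 x m j (vx l j k).
    by move=> ->.
  (* For [k = 0] only [k' <= 1] matters, and there [stage3] of the confined bump is zero. *)
  have b30 : k = 0%N -> stage3 y 0 pred0 (vx l j k') = 0.
    move=> k0; rewrite k0 in kk'; rewrite /stage3; case: (k') k'j kk' => [|k1] h1 h2; first by rewrite build0.
    by rewrite buildS//= h2.
  apply: chain3_mul0; [exact: sep|exact: s1y|exact: s1r|..];
    (have [k0|k0] := posnP k; last by have [e2 e3] := s23 k0; rewrite ?e2 ?e3 mul0r).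
  + by rewrite e20// s1y.
  + by rewrite e20// s1r.
  + by rewrite b30// mulr0.
  + by rewrite e30// s1r.
  + by rewrite b30// mulr0.
Qed.

Lemma inner_unique s j j' c : inner s j c -> inner s j' c -> j = j'.
Proof.
move=> inn inn'; have [L [Ll _ y1 _ _] L0] := inner_outer inn.
apply/eqP/negPn/negP => jj'; have := inner_off inn' jj' Ll.
by rewrite y1 => /eqP; rewrite oner_eq0.
Qed.

(** On a common branch one of [L <= K.+1] and [K <= L.+1] would hold, and the corresponding gap
    condition would make the product of the two peak values vanish. So the branches differ, and bump
    [s] is zero off branch [i]. *)
Lemma inner_both s i j c : inner s j c -> inner (~~ s) i c ->
  [/\ i != j, forall b d k, b != i -> rmax (side c s) b d k = 0,
      reach s j c = 0 & forall b k, b != i -> (k <= l b)%N -> side c s (vx l b k) = 0].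
Proof.
move=> inn inn'; have [L [Ll _ y1 _ _] L0] := inner_outer inn.
have [K [Kl _ x1 _ _] K0] := inner_outer inn'; rewrite negbK in x1.
have off b k : b != i -> (k <= l b)%N -> side c s (vx l b k) = 0.
  by move=> bi kb; have := inner_off inn' bi kb; rewrite negbK.
have ij : i != j.
  apply/eqP => ij; subst i.
  have [_ _ _ sep] := inn; have [_ _ _] := inn'; rewrite negbK => sep'.
  have one : (1 : R) * 1 <> 0 by rewrite mulr1; apply/eqP; exact: oner_neq0.
  rewrite /side in x1 y1; have [LK|KL] := leqP L K.+1.
    by apply: one; rewrite -{1}x1 -y1 sep.
  by apply: one; rewrite -{1}y1 -x1 sep'//; lia.
have roff b d k : b != i -> rmax (side c s) b d k = 0.
  by move=> bi; apply: rmax_eq0 => k' _; exact: off.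
by split=> //; rewrite /reach roff// eq_sym.
Qed.

(** Here [reach] is 0 and bump [s] already vanishes on branch [j], so clearing that branch changes
    nothing and the formulas for an inner and for a confined bump coincide. *)
Lemma hop_overlap_aux s i j c t v : inner s j c -> inner (~~ s) i c ->
  hop s j c t (s, v) = hop (~~ s) i c t (s, v).
Proof.
move=> inn inn'; have [ij roff m0 off] := inner_both inn inn'.
rewrite -[LHS]/(side (hop s j c t) s v) side_hop m0.
have -> : hop (~~ s) i c t (s, v) = side (hop (~~ s) i c t) (~~ ~~ s) v by rewrite negbK.
rewrite side_hopN negbK; set x := side c s.
have ji : j != i by rewrite eq_sym.
have rj d k : rmax x j d k = 0 by apply: roff.
have x0 b k : (k <= l b)%N -> 0 <= x (vx l b k).
  by have [[i' [K' [_ x0 _ _ _]]] _ _ _] := inn => _; exact: x0.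
have [b [k [kb ->]]] := vxP i v; rewrite /stage1 /stage2 /stage3.
case: k kb => [|k] kb.
  rewrite !build0; have -> : x (vx l b 0) = 0 by rewrite -[vx l b 0]/(vx l j 0); apply: off.
  by [].
rewrite !buildS//=; case: (eqVneq b j) => [bj|bj]; last by rewrite (max_l (x0 _ _ kb)).
by subst b; rewrite !rj maxxx if_same; congr (chain3 _ _ _ _ t); rewrite /x off.
Qed.

Lemma hop_overlap p q c t : inner p.1 p.2 c -> inner q.1 q.2 c ->
  hop p.1 p.2 c t = hop q.1 q.2 c t.
Proof.
case: p q => [s j] [s' j'] /= h h'; have [ss|ss] := eqVneq s s'.
  by subst s'; rewrite (inner_unique h h').
have sE : s' = ~~ s by case: s s' ss {h h'} => [] [].
subst s'; apply/funext => -[a v]; have [->|as_] := eqVneq a s.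
  exact: hop_overlap_aux.
have -> : a = ~~ s by case: a s as_ {h h' ss} => [] [].
have := @hop_overlap_aux (~~ s) j j' c t v h'; rewrite negbK => /(_ h) ->.
by [].
Qed.

(** Reach 1 is the vertex (~~ s, j), reach 0 the midpoint of an edge. The remaining weight goes to
    the branch whose maximum exceeds [reach], which singles out the peak of bump [s] by a continuous
    formula. *)
Definition to_crown s j c : EG := fun p =>
  if p.1 == s then Num.max 0 (rmax (side c s) p.2 1 (l p.2) - reach s j c) / 2
  else (p.2 == j)%:R * ((1 + reach s j c) / 2).

Lemma exists_neq (j : 'I_n) : exists i : 'I_n, i != j.
Proof.
case: (n) n2 j => [|[|m]] // _ j; exists (if j == ord0 then ord_max else ord0).
by case: (eqVneq j ord0) => [->|//]; rewrite eq_sym.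
Qed.

(** If [reach] is 1, no branch stands out and any [i != j] will do; its weight in the crown is then
    zero. *)
Lemma inner_peak s j c : inner s j c -> exists i, i != j /\
  forall b, b != j -> Num.max (reach s j c) (rmax (side c s) b 1 (l b)) =
    if b == i then 1 else reach s j c.
Proof.
move=> inn; have m01 := reach01 inn; have /andP[m0 m1] := m01.
have r1 b d k : rmax (side c s) b d k <= 1.
  have [[i [K bx]] _ _ _] := inn; apply: rmax_le => // k' _ _; exact: bump_le1 bx.
case: (inner_cases inn) => [mE|[i [K [bx K0 ij dom]]]].
  by have [i ij] := exists_neq j; exists i; split=> // b bj; rewrite mE if_same max_l.
exists i; split=> // b bj; have [Kl _ _ _ _] := bx; case: eqVneq => [->|bi].
  by rewrite (rmax_root bx K0 Kl) max_r.
by rewrite max_l//; apply: rmax_le => // k _; exact: dom.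
Qed.

Lemma to_crownE s j c : inner s j c -> exists i, [/\ i != j,
  forall b, b != j -> Num.max (reach s j c) (rmax (side c s) b 1 (l b)) =
    (if b == i then 1 else reach s j c) &
  to_crown s j c = fun v => (1 - reach s j c) / 2 * pt (s, i) v
                          + (1 + reach s j c) / 2 * pt (~~ s, j) v].
Proof.
move=> inn; have [i [ij peak]] := inner_peak inn; exists i; split=> //.
have /andP[m0 m1] := reach01 inn.
apply/funext => -[a b]; rewrite /to_crown /pt /= !xpair_eqE.
have [->|as_] := eqVneq a s; last first.
  have -> : a = ~~ s by case: a s as_ {inn ij peak m0 m1} => [] [].
  by rewrite eqxx /= mulr0 add0r mulrC.
have -> : (s == ~~ s) = false by case: s {inn ij peak m0 m1}.
rewrite /= mulr0 addr0; set m := reach s j c; set r := rmax _ _ _ _.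
suff -> : Num.max 0 (r - m) = (1 - m) * (b == i)%:R by rewrite mulrAC.
have -> : Num.max 0 (r - m) = Num.max m r - m.
  by rewrite addr_maxl subrr.
have [bj|bj] := eqVneq b j.
  subst b; rewrite eq_sym (negPf ij) mulr0 max_l ?subrr//.
  exact: rmax_sub.
rewrite peak//; case: eqP => _; first by rewrite mulr1.
by rewrite subrr mulr0.
Qed.

Lemma seg_crown s (i j : 'I_n) (g : EG) : i != j -> seg (s, i) (~~ s, j) g ->
  crown_set g.
Proof.
case: s => /= ij gs; last by exists (i, j).
by exists (j, i); split; [rewrite eq_sym|rewrite segC].
Qed.

Lemma crown_side (g : EG) : crown_set g -> exists s i j (p : R),
  [/\ i != j, 0 <= p, 2 * p <= 1 &
      g = fun v => p * pt (s, i) v + (1 - p) * pt (~~ s, j) v].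
Proof.
move=> [[i j] /= [ij gs]].
have [gE g1] := seg_pair (isT : (false, i) != (true, j)) gs; have [g0 _ _] := gs.
have [h|h] := leP (2 * g (false, i)) 1.
  exists false, i, j, (g (false, i)); split=> //=.
  by apply/funext => v; rewrite [LHS](congr1 (@^~ v) gE); congr (_ + _ * _); lra.
exists true, j, i, (g (true, j)); split=> //=; first by rewrite eq_sym.
  lra.
by apply/funext => v; rewrite [LHS](congr1 (@^~ v) gE) addrC; congr (_ + _ * _); lra.
Qed.

(** On the half-edge where (s, i) has weight p at most 1/2, this is 1 - 2p for bump [s], the reach
    to be restored, and its negative for the other bump. *)
Definition excess (g : EG) s : R := \sum_b g (~~ s, b) - \sum_b g (s, b).

(** One formula for both bumps on all half-edges, so continuity needs no gluing. The first summand
    is the reach, cleared on the branch of the other bump. From distance two on, the second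
    completes 1 - 2p by 2p for the inner bump, and is 2(1 - p) cut off at 1 for the confined one. *)
Definition of_crown (g : EG) : EC := fun p =>
  build (Num.max 0 (excess g p.1)) (fun b k =>
    Num.max 0 (excess g p.1 - 2 * g (~~ p.1, b)) +
    if (k <= 1)%N then 0 else Num.min 1 (2 * g (p.1, b))) p.2.

Lemma sum_ptE (s a : bool) (i : 'I_n) : \sum_b pt (s, i) (a, b) = (a == s)%:R :> R.
Proof.
rewrite /pt; under eq_bigr => b _ do rewrite xpair_eqE.
case: (a == s) => /=; last by rewrite big1.
by rewrite (bigD1 i)//= eqxx big1 ?addr0// => b /negPf->.
Qed.

Section OfCrown.
Variables (s : bool) (i j : 'I_n) (p : R).
Hypotheses (ij : i != j) (p0 : 0 <= p) (p1 : 2 * p <= 1).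
Let g : EG := fun v => p * pt (s, i) v + (1 - p) * pt (~~ s, j) v.

Lemma excessE : excess g s = 1 - 2 * p /\ excess g (~~ s) = 2 * p - 1.
Proof.
rewrite /excess /g negbK !big_split/= -!mulr_sumr !sum_ptE !eqxx.
have -> : (s == ~~ s) = false by case: (s).
have -> : (~~ s == s) = false by case: (s).
by split; rewrite !(mulr0, mulr1); lra.
Qed.

Lemma edge_pointE b : g (s, b) = p * (b == i)%:R /\ g (~~ s, b) = (1 - p) * (b == j)%:R.
Proof.
rewrite /g /pt !xpair_eqE !eqxx /=.
have -> : (s == ~~ s) = false by case: (s).
have -> : (~~ s == s) = false by case: (s).
by rewrite /= !mulr0 addr0 add0r.
Qed.

Lemma of_crown_in : side (of_crown g) s = build (1 - 2 * p) (fun b k =>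
  if b == j then 0 else if (b == i) && (2 <= k)%N then 1 else 1 - 2 * p).
Proof.
have q0 := p0; have q1 := p1; have [e1 e2] := excessE; apply/funext => -[[b o]|]; rewrite /side /of_crown /=.
  have [-> ->] := edge_pointE b; rewrite e1; case: (eqVneq b j) => [bj|bj].
    have -> : (b == i) = false by rewrite bj eq_sym (negPf ij).
    rewrite !mulr0 mulr1 max_l; last lra.
    by rewrite min_r// if_same addr0.
  rewrite !mulr0 subr0 max_r; last lra.
  case: (eqVneq b i) => /= _; last by rewrite !mulr0 min_r// if_same addr0.
  case: (nat_of_ord o) => [|k] /=; first by rewrite addr0.
  by rewrite mulr1 min_r//; lra.
by rewrite e1 max_r//; lra.
Qed.

Lemma of_crown_out : side (of_crown g) (~~ s) = build 0 (fun b k =>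
  if (b == j) && (2 <= k)%N then 1 else 0).
Proof.
have q0 := p0; have q1 := p1; have [e1 e2] := excessE; apply/funext => -[[b o]|]; rewrite /side /of_crown /=.
  rewrite negbK; have [-> ->] := edge_pointE b; rewrite e2.
  have h : 0 <= 2 * (p * (b == i)%:R) :> R by rewrite !mulr_ge0.
  rewrite max_l; last lra.
  rewrite add0r; case: (eqVneq b j) => /= _; last by rewrite !mulr0 min_r// if_same.
  case: (nat_of_ord o) => [|k] //=.
  by rewrite mulr1 min_l//; lra.
by rewrite e2 max_l//; lra.
Qed.

Lemma of_crown_inner : inner s j (of_crown g).
Proof.
have q0 := p0; have q1 := p1; have li := l2 i; have lj := l2 j; split.
- exists i, (l i); rewrite of_crown_in; split=> //.
  + case=> [[b o]|] /=; last lra.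
    by case: ifP => // _; case: ifP => // _; lra.
  + have lE : (l i).-2.+2 = l i by lia.
    rewrite -{1}lE buildS; last lia.
    by rewrite (negPf ij) eqxx.
  + move=> b k kl bK; have bi : b != i.
      by case/orP: bK => // h; apply/eqP => bi; rewrite bi in kl; lia.
    rewrite buildS// (negPf bi); case: k kl {bK} => [|k] kl.
      by rewrite build0; case: ifP => // _; lra.
    by rewrite buildS ?(ltnW kl)// (negPf bi).
  + move=> k kl; rewrite buildS// (negPf ij) eqxx; case: k kl => [|k] kl.
      by rewrite build0.
    by rewrite buildS ?(ltnW kl)// (negPf ij) eqxx /=; case: ifP => // _; lra.
- exists j, (l j); rewrite of_crown_out; split=> //.
  + by case=> [[b o]|] //=; case: ifP.
  + have lE : (l j).-2.+2 = l j by lia.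
    by rewrite -{1}lE buildS ?eqxx//; lia.
  + move=> b k kl bK; have bi : b != j.
      by case/orP: bK => // h; apply/eqP => bi; rewrite bi in kl; lia.
    rewrite buildS// (negPf bi); case: k kl {bK} => [|k] kl; first by rewrite build0.
    by rewrite buildS ?(ltnW kl)// (negPf bi).
  + move=> k kl; rewrite buildS// eqxx; case: k kl => [|k] kl; first by rewrite build0.
    by rewrite buildS ?(ltnW kl)// eqxx /=; case: ifP.
- move=> v; rewrite -[of_crown g _]/(side (of_crown g) (~~ s) v) of_crown_out.
  by case: v => [[b o]|] //=; rewrite andbT => /negPf->.
- move=> k k' kj k'j kk'; rewrite -[X in X * _]/(side (of_crown g) s _).
  rewrite -[X in _ * X]/(side (of_crown g) (~~ s) _) of_crown_in of_crown_out.
  case: k kj kk' => [|k] kj kk'; last by rewrite buildS// eqxx mul0r.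
  case: k' k'j kk' => [|[|k']] k'j // _; first by rewrite [X in _ * X]build0 mulr0.
  by rewrite [X in _ * X]buildS// andbF mulr0.
Qed.

Lemma of_crownK : to_crown s j (of_crown g) = g.
Proof.
have q0 := p0; have q1 := p1; have mE : reach s j (of_crown g) = 1 - 2 * p.
  rewrite /reach of_crown_in; apply/le_anti/andP; split.
    apply: rmax_le; first lra.
    by case=> [|k] _ kl; rewrite ?build0// buildS// eqxx; lra.
  exact: (@rmax_ge R n l (build _ _) j 0 (l j) 0).
apply/funext => -[a b]; rewrite /to_crown /= mE; have [->|as_] := eqVneq a s; last first.
  have -> : a = ~~ s by case: a (s) as_ => [] [].
  by have [_ ->] := edge_pointE b; lra.
have [-> _] := edge_pointE b; rewrite of_crown_in.
have [bj|bj] := eqVneq b j.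
  rewrite (_ : rmax _ _ _ _ = 0); last first.
    by apply: rmax_eq0 => -[|k] // _ kl; rewrite buildS// bj eqxx.
  have -> : (b == i) = false by rewrite bj eq_sym (negPf ij).
  by rewrite max_l ?mulr0 ?mul0r//; lra.
have lb := l2 b; have [bi|bi] := eqVneq b i.
  rewrite (_ : rmax _ _ _ _ = 1); first by rewrite max_r ?mulr1; lra.
  apply/le_anti/andP; split.
    apply: rmax_le => // -[|k] // _ kl; rewrite buildS// (negPf bj).
    by case: ifP => // _; lra.
  have := @rmax_ge R n l (build (1 - 2 * p) (fun b k => if b == j then 0
    else if (b == i) && (2 <= k)%N then 1 else 1 - 2 * p)) b 1 (l b) 2.
  by rewrite buildS//= (negPf bj) bi eqxx -bi; apply; lia.
rewrite (_ : rmax _ _ _ _ = 1 - 2 * p); first by rewrite subrr maxxx mulr0 mul0r.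
apply/le_anti/andP; split.
  by apply: rmax_le => [|[|k] // _ kl]; [lra|rewrite buildS// (negPf bj) (negPf bi)].
have := @rmax_ge R n l (build (1 - 2 * p) (fun b k => if b == j then 0
    else if (b == i) && (2 <= k)%N then 1 else 1 - 2 * p)) b 1 (l b) 1.
by rewrite buildS ?(ltnW lb)//= (negPf bj) (negPf bi); apply; lia.
Qed.

End OfCrown.

(** [stage3] depends only on the reach and on the branch maxima, which the crown coordinates
    record. *)
Lemma of_to_crown s j c : inner s j c -> of_crown (to_crown s j c) = hop s j c 1.
Proof.
move=> inn; have [i [ij peak fE]] := to_crownE inn.
have /andP[m0 m1] := reach01 inn; set m := reach s j c in m0 m1 peak fE *.
have [L by_ L0] := inner_outer inn; have [Ll _ _ _ _] := by_.
pose p := (1 - m) / 2.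
have p0 : 0 <= p by rewrite /p; lra.
have p1 : 2 * p <= 1 by rewrite /p; lra.
have {}fE : to_crown s j c = fun v => p * pt (s, i) v + (1 - p) * pt (~~ s, j) v.
  by rewrite fE; apply/funext => v; congr (_ + _ * _); rewrite /p; lra.
have pm : 1 - 2 * p = m by rewrite /p; lra.
rewrite fE; apply/funext => -[a v]; have [->|as_] := eqVneq a s.
  rewrite -[LHS]/(side (of_crown _) s v) of_crown_in// pm.
  rewrite -[RHS]/(side (hop s j c 1) s v) side_hop chain3_1// /stage3 -/m.
  case: v => [[b o]|] //=; case: (eqVneq b j) => //= bj; rewrite peak//.
  by case: (nat_of_ord o) => [|k]; case: (b == i).
have -> : a = ~~ s by case: a (s) as_ => [] [].
rewrite -[LHS]/(side (of_crown _) (~~ s) v) of_crown_out//.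
rewrite -[RHS]/(side (hop s j c 1) (~~ s) v) side_hopN chain3_1// /stage3.
case: v => [[b o]|] //=; case: (eqVneq b j) => [bj|bj] /=.
  case: (nat_of_ord o) => //= _; subst b.
  by rewrite (rmax_root by_ L0 Ll) max_r.
case: ifP => // _; rewrite rmax_eq0 ?maxxx// => k _ kl.
by rewrite (inner_off inn).
Qed.

(** Both reaches vanish on the overlap of different sides, so either formula gives the midpoint of
    the same edge. *)
Lemma to_crown_overlap p q c : inner p.1 p.2 c -> inner q.1 q.2 c ->
  to_crown p.1 p.2 c = to_crown q.1 q.2 c.
Proof.
case: p q => [s j] [s' j'] /= h h'; have [ss|ss] := eqVneq s s'.
  by subst s'; rewrite (inner_unique h h').
have sE : s' = ~~ s by case: s s' ss {h h'} => [] [].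
subst s'; have [ij roff m0 off] := inner_both h h'.
have hN : inner (~~ ~~ s) j c by rewrite negbK.
have [_ roff' m0' off'] := inner_both h' hN.
have [K bx K0] := inner_outer h'; rewrite negbK in bx; have [Kl _ _ _ _] := bx.
have [L by_ L0] := inner_outer h; have [Ll _ _ _ _] := by_.
apply/funext => -[a b]; rewrite /to_crown /= m0 m0' !subr0 addr0.
have [->|as_] := eqVneq a s.
  have -> : (s == ~~ s) = false by case: (s).
  have [->|bj] := eqVneq b j'; first by rewrite (rmax_root bx K0 Kl) max_r ?mul1r.
  by rewrite roff// maxxx !mul0r.
have -> : a = ~~ s by case: a (s) as_ => [] [].
rewrite eqxx; have [->|bj] := eqVneq b j; first by rewrite (rmax_root by_ L0 Ll) max_r ?mul1r.
by rewrite roff'// maxxx !mul0r.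
Qed.

Let cts_c (s : bool) (v : V) : continuous (fun c : EC => side c s v).
Proof. by apply: (@cts_coord R EC _ (fun g => g) (s, v)) => g. Qed.

Let cts_reach s j : continuous (fun c : EC => reach s j c).
Proof. by apply: cts_rmax => v; exact: cts_c. Qed.

Lemma cts_to_crown s j : continuous (to_crown s j : EC -> EG).
Proof.
apply: cts_prod => -[a b]; rewrite /to_crown /=; apply: cts_if.
  apply: ctsM; last exact: cts_cst.
  apply: cts_max; first exact: cts_cst.
  apply: ctsD; last by apply: ctsN; exact: cts_reach.
  by apply: cts_rmax => v; exact: cts_c.
apply: ctsM; first exact: cts_cst.
apply: ctsM; last exact: cts_cst.
by apply: ctsD; [exact: cts_cst|exact: cts_reach].
Qed.

Lemma cts_of_crown : continuous of_crown.
Proof.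
have cg (a : bool * 'I_n) : continuous (fun g : EG => g a).
  by apply: (@cts_coord R EG _ (fun g => g) a) => g.
have ce s : continuous (fun g : EG => excess g s).
  by apply: ctsD; [|apply: ctsN]; apply: cts_sum => b _; exact: cg.
apply: cts_prod => -[s [[b o]|]]; rewrite /of_crown /=; last first.
  by apply: cts_max => //; exact: cts_cst.
apply: ctsD.
  apply: cts_max; first exact: cts_cst.
  apply: ctsD => //; apply: ctsN; apply: ctsM => //; exact: cts_cst.
apply: cts_if; first exact: cts_cst.
apply: cts_min; first exact: cts_cst.
by apply: ctsM => //; exact: cts_cst.
Qed.

Lemma cts_hop (T : topologicalType) (f : T -> EC) (h : T -> R) s j :
  continuous f -> continuous h -> continuous (fun t => hop s j (f t) (h t)).
Proof.
move=> cf ch; apply: cts_prod => -[a v]; rewrite /hop /=.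
have cs b u : continuous (fun t => side (f t) b u) by exact: (cts_comp (@cts_c b u) cf).
have cr : continuous (fun t => reach s j (f t)) by exact: (cts_comp (@cts_reach s j) cf).
have crm b d e k : continuous (fun t => rmax (side (f t) b) d e k).
  by apply: cts_rmax => u; exact: cs.
have c0 (x : R) : continuous (fun _ : T => x) by exact: cts_cst.
apply: cts_if; apply: cts_chain3 => //; case: v => [[b o]|] //=;
  rewrite /stage1 /stage2 /stage3 /build //=; repeat (apply: cts_if => //);
  by apply: cts_max.
Qed.

Local Notation C := (set_type (@pair_set R n l)).
Let piece (p : bool * 'I_n) : set C := [set c | inner p.1 p.2 (set_val c)].

Let closed_piece p : closed (piece p).
Proof.
case: p => s j.
have cv a v : continuous (fun c : C => set_val c (a, v) : R).
  exact: (cts_comp (@cts_c a v) (@cts_val _ _)).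
(* Membership in [pair_set] already provides the two bumps; what cuts out the piece are vanishing
   conditions on continuous functions. *)
rewrite (_ : piece _ =
    [set c : C | forall v, (if beyond j 1 v then 0 else set_val c (~~ s, v)) = 0] `&`
    [set c : C | forall q : nat * nat,
       (if [&& (q.1 <= l j), (q.2 <= l j) & (q.2 <= q.1.+1)]%N
        then set_val c (s, vx l j q.1) * set_val c (~~ s, vx l j q.2) else 0) = 0]).
  apply: closedI; apply: closed_all => q; apply: closed_eq0; apply: cts_if => //;
    try exact: cts_cst.
  exact: ctsM.
apply/seteqP; split=> c /=; rewrite /piece /=.
- move=> [_ _ out sep]; split=> [v|[k k'] /=]; first by case: ifP => // /negbT/out.
  by case: ifP => // /and3P[]; exact: sep.
- move=> [out sep]; have [i [K [i' [L [bx by_]]]]] := pair_bumps (set_type_mem c).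
  split.
  + by case: (s); [exists i', L|exists i, K].
  + by case: (s); [exists i, K|exists i', L].
  + by move=> v /negPf nb; have := out v; rewrite nb.
  + by move=> k k' h1 h2 h3; have := sep (k, k'); rewrite /= h1 h2 h3.
Qed.

Let piece_cover (c : C) : exists p, piece p c.
Proof. exact: (set_type_mem c). Qed.

Lemma pairs_crown : homotopy_equivalent R C (set_type (@crown_set R n)).
Proof.
have [||F [cF FE]] := @glue_closed C EG _ piece
  (fun p (c : C) => to_crown p.1 p.2 (set_val c)) closed_piece _ piece_cover.
- by move=> p; exact: (cts_comp (@cts_to_crown p.1 p.2) (@cts_val _ _)).
- by move=> p q c; exact: to_crown_overlap.
have FG (c : C) : crown_set (F c).
  have [[s j] inn] := piece_cover c; rewrite (FE _ _ inn) /=.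
  have [i [ij _ ->]] := to_crownE inn; have /andP[m0 m1] := reach01 inn.
  apply: (seg_crown ij) => /=; set m := reach _ _ _ in m0 m1 *.
  have h := @seg_convex R _ (s, i) (~~ s, j) (pt (s, i)) (pt (~~ s, j)) ((1 + m) / 2).
  have -> : (1 - m) / 2 = 1 - (1 + m) / 2 by lra.
  by apply: h; [lra|exact: pt_seg|rewrite segC; exact: pt_seg].
have gP (g : set_type (@crown_set R n)) : pair_set (of_crown (set_val g)).
  have [s [i [j [p [ij p0 p1 ->]]]]] := crown_side (set_type_mem g).
  by exists (s, j); exact: of_crown_inner.
exists (to_sub FG), (to_sub gP); split.
- exact: cts_sub.
- by apply: cts_sub; exact: (cts_comp cts_of_crown (@cts_val _ _)).
- pose W := (C * unit_interval R)%type.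
  have c1 : continuous (fun p : W => set_val p.1 : EC).
    by apply: (cts_comp (@cts_val _ _)); exact: cts_fst.
  have c2 : continuous (fun p : W => set_val p.2 : R).
    by apply: (cts_comp (@cts_val _ _)); exact: cts_snd.
  have [||||H [cH HE]] := @glue_closed W EC _ (fun p => [set w | piece p w.1])
    (fun p w => hop p.1 p.2 (set_val w.1) (set_val w.2)).
  + move=> p; apply: (@closed_comp W C fst (piece p)); last exact: closed_piece.
    by move=> x _; exact: cts_fst.
  + by move=> p; exact: cts_hop.
  + by move=> w; exact: piece_cover.
  + by move=> p q w; exact: hop_overlap.
  have HP w : pair_set (H w).
    have [p inn] := piece_cover w.1; rewrite (HE p)//.
    by exists p; exact: inner_hop.
  apply: homotopic_sym; exists (to_sub HP); split; first exact: cts_sub.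
  split=> c t tE; apply: set_val_inj; rewrite to_subE; have [p inn] := piece_cover c;
    rewrite (HE p)//= tE.
  + apply/funext => -[a v]; rewrite /hop /=.
    have [->|as_] := eqVneq a p.1; first by rewrite chain3_0.
    have -> : a = ~~ p.1 by case: a (p.1) as_ => [] [].
    by rewrite chain3_0.
  + by rewrite -of_to_crown// -(FE p c inn).
- rewrite (_ : _ \o _ = idfun); first by apply: homotopic_refl => x.
  apply/funext => g; apply: set_val_inj; rewrite /= to_subE.
  have [s [i [j [p [ij p0 p1 gE]]]]] := crown_side (set_type_mem g).
  have inn : piece (s, j) (to_sub gP g).
    by rewrite /piece /= to_subE gE; exact: of_crown_inner.
  by rewrite (FE _ _ inn) /= to_subE gE of_crownK.
Qed.

End Retract.

Theorem theorem8p1 (R : realType) (n : nat) (l : 'I_n -> nat) :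
  (3 <= n)%N -> (forall i, (2 <= l i)%N) ->
  homotopy_equivalent R (set_type (@dataP R _ (@star_adj n l)))
                        (bouquet R (n ^ 2 - 3 * n + 1)).
Proof.
case: n l => [|[|[|m]]] // l _ l2.
apply: homotopy_equivalent_trans (crown_bouquet m).
apply: homotopy_equivalent_trans (pairs_crown l2 isT).
exact: data_pairs ord0.
Qed.
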